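(* There is a promptly simple set $A\subseteq\mathbb{N}$ such that $A\le_T Z$ for every superhigh Martin-Löf random set $Z\subseteq\mathbb{N}$.
   Context: A set $Z$ is superhigh if $Z'\ge_{tt}\emptyset''$, where $Z'$ is the Turing jump of $Z$ and $\le_{tt}$ is truth-table reducibility. Martin-Löf randomness is with respect to the fair-coin (Lebesgue) measure on $2^{\mathbb{N}}$. A computably enumerable set $A$ is promptly simple if it is co-infinite and there are a computable function $p$ and a computable enumeration $(A_s)_{s\in\mathbb{N}}$ of $A$ such that for each $e$, if $W_e$ is infinite then there are $s$ and $x$ with $x\in W_{e,s}\setminus W_{e,s-1}$ and $x\in A_{p(s)}$. Here $(W_e)_{e\in\mathbb{N}}$ is the standard list of c.e. sets with standard stage approximations $W_{e,s}$. *)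

(* Defs.v *)
From HB Require Import structures.
From Stdlib Require Cantor.
From mathcomp Require Import all_boot all_order all_algebra.
From mathcomp Require Import all_classical all_reals all_analysis.
From mathcomp Require Import zify lra.

Set Implicit Arguments.
Unset Strict Implicit.
Unset Printing Implicit Defensive.

Import Order.TTheory GRing.Theory Num.Theory.

Local Open Scope classical_set_scope.

(* Subsets of N that serve as oracles, and points of Cantor space 2^N, are    *)
(* characteristic functions nat -> bool.                                      *)

Notation pair_code x y := (Cantor.to_nat (x, y)).
Arguments Cantor.to_nat : simpl never.
Arguments Cantor.of_nat : simpl never.

(* Kleene's partial recursive functions relative to an oracle, presented as   *)
(* unary functions on numbers with pairing.                                   *)
Inductive prog : Type :=
| PZero | PSucc | PFst | PSnd | POracle
| PPair of prog & prog
| PComp of prog & prog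
| PRec of prog & prog
| PMin of prog.

(* [run X s c x] is the output of program c on input x with oracle X, if the  *)
(* computation has nesting depth at most s. Writing <a, n> for pairing:       *)
(*   PRec f g <a, 0>   = f a,                                                 *)
(*   PRec f g <a, n+1> = g <a, <n, PRec f g <a, n>>>,                         *)
(*   PMin f <a, m>     = the least n >= m with f <a, n> = 0, provided that    *)
(*                       f <a, i> converges for m <= i <= n.                  *)
Fixpoint run (X : nat -> bool) (s : nat) (c : prog) (x : nat) {struct s} :
    option nat :=
  if s isn't s'.+1 then None else
  match c with
  | PZero => Some 0
  | PSucc => Some x.+1
  | PFst => Some (Cantor.of_nat x).1
  | PSnd => Some (Cantor.of_nat x).2
  | POracle => Some (X x : nat)
  | PPair f g =>
      if run X s' f x is Some y then
        omap (fun z => pair_code y z) (run X s' g x)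
      else None
  | PComp f g => obind (run X s' f) (run X s' g x)
  | PRec f g =>
      let: (a, n) := Cantor.of_nat x in
      if n is m.+1 then
        obind (fun y => run X s' g (pair_code a (pair_code m y)))
              (run X s' c (pair_code a m))
      else run X s' f a
  | PMin f =>
      let: (a, m) := Cantor.of_nat x in
      if run X s' f x is Some y then
        if y == 0 then Some m else run X s' c (pair_code a m.+1)
      else None
  end.

Lemma run_mono X s s' c x y :
  s <= s' -> run X s c x = Some y -> run X s' c x = Some y.
Proof.
elim: s s' c x y => [|s IH] [|s'] // c x y; rewrite ltnS => ss'.
have IHs c' x' y' := IH s' c' x' y' ss'.
case: c => //= [f g|f g|f g|f].
- case Ef: (run X s f x) => [u|] //; rewrite (IHs _ _ _ Ef).
  by case Eg: (run X s g x) => [v|] //; rewrite (IHs _ _ _ Eg).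
- case Eg: (run X s g x) => [v|] //=; rewrite (IHs _ _ _ Eg) /=.
  exact: IHs.
- case: (Cantor.of_nat x) => a [|m]; first exact: IHs.
  case Er: (run X s _ _) => [v|] //=; rewrite (IHs _ _ _ Er) /=.
  exact: IHs.
- case: (Cantor.of_nat x) => a m.
  case Ef: (run X s f x) => [u|] //; rewrite (IHs _ _ _ Ef).
  by case: ifP => // _; apply: IHs.
Qed.

Fixpoint encode (c : prog) : nat :=
  match c with
  | PZero => 0 | PSucc => 1 | PFst => 2 | PSnd => 3 | POracle => 4
  | PPair f g => 5 + 4 * pair_code (encode f) (encode g)
  | PComp f g => 6 + 4 * pair_code (encode f) (encode g)
  | PRec f g => 7 + 4 * pair_code (encode f) (encode g)
  | PMin f => 8 + 4 * encode f
  end.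

Fixpoint decode_rec (k e : nat) : prog :=
  if k isn't k'.+1 then PZero else
  match e with
  | 0 => PZero | 1 => PSucc | 2 => PFst | 3 => PSnd | 4 => POracle
  | e'.+4.+1 =>
      let q := e' %/ 4 in
      let f := decode_rec k' (Cantor.of_nat q).1 in
      let g := decode_rec k' (Cantor.of_nat q).2 in
      match e' %% 4 with
      | 0 => PPair f g
      | 1 => PComp f g
      | 2 => PRec f g
      | _ => PMin (decode_rec k' q)
      end
  end.

Definition decode (e : nat) : prog := decode_rec e.+1 e.

Lemma pair_code_ge x y : x <= pair_code x y /\ y <= pair_code x y.
Proof.
have := Cantor.to_nat_non_decreasing x y.
by move=> /ssrnat.leP H; split; apply: leq_trans H; rewrite ?leq_addl ?leq_addr.
Qed.

Lemma encodeK : cancel encode decode.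
Proof.
suff H k c : encode c < k -> decode_rec k (encode c) = c.
  by move=> c; exact: H.
elim: k c => // k IH c.
have step n r : r < 4 -> (r + 4 * n) %/ 4 = n /\ (r + 4 * n) %% 4 = r.
  by move=> r4; split; lia.
case: c => // [f g|f g|f g|f] Hc.
- have [Hf Hg] := pair_code_ge (encode f) (encode g).
  move: Hc; change (encode (PPair f g)) with
    ((0 + 4 * pair_code (encode f) (encode g)).+4.+1) => Hc.
  have [E1 E2] := step (pair_code (encode f) (encode g)) 0 isT.
  by rewrite /= -/muln E1 E2 Cantor.cancel_of_to /= !IH //; lia.
- have [Hf Hg] := pair_code_ge (encode f) (encode g).
  move: Hc; change (encode (PComp f g)) with
    ((1 + 4 * pair_code (encode f) (encode g)).+4.+1) => Hc.
  have [E1 E2] := step (pair_code (encode f) (encode g)) 1 isT.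
  by rewrite [LHS]/= -/muln E1 E2 Cantor.cancel_of_to /= !IH //; lia.
- have [Hf Hg] := pair_code_ge (encode f) (encode g).
  move: Hc; change (encode (PRec f g)) with
    ((2 + 4 * pair_code (encode f) (encode g)).+4.+1) => Hc.
  have [E1 E2] := step (pair_code (encode f) (encode g)) 2 isT.
  by rewrite [LHS]/= -/muln E1 E2 Cantor.cancel_of_to /= !IH //; lia.
- move: Hc; change (encode (PMin f)) with ((3 + 4 * encode f).+4.+1) => Hc.
  have [E1 E2] := step (encode f) 3 isT.
  by rewrite [LHS]/= -/muln E1 E2 /= IH //; lia.
Qed.

Lemma decodeK : cancel decode encode.
Proof.
suff H k e : e < k -> encode (decode_rec k e) = e by move=> e; exact: H.
elim: k e => // k IH [|[|[|[|[|e]]]]] // Hk.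
have He := divn_eq e 4; have Hr : e %% 4 < 4 by rewrite ltn_mod.
have [] := pair_code_ge (Cantor.of_nat (e %/ 4)).1 (Cantor.of_nat (e %/ 4)).2.
have EE : pair_code (Cantor.of_nat (e %/ 4)).1 (Cantor.of_nat (e %/ 4)).2
  = e %/ 4 by rewrite -surjective_pairing Cantor.cancel_to_of.
rewrite EE => H1 H2.
have Hq : e %/ 4 <= e by exact: leq_div.
rewrite [decode_rec _ _]/=.
have I1 : encode (decode_rec k (Cantor.of_nat (e %/ 4)).1) =
  (Cantor.of_nat (e %/ 4)).1 by apply: IH; lia.
have I2 : encode (decode_rec k (Cantor.of_nat (e %/ 4)).2) =
  (Cantor.of_nat (e %/ 4)).2 by apply: IH; lia.
have I3 : encode (decode_rec k (e %/ 4)) = e %/ 4 by apply: IH; lia.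
by case Er: (e %% 4) => [|[|[|[|r]]]]; rewrite [LHS]/= ?I1 ?I2 ?I3 ?EE; lia.
Qed.

Definition computable_in (X : nat -> bool) (f : nat -> nat) : Prop :=
  exists c : prog, forall x, exists s, run X s c x = Some (f x).

Definition oracle0 : nat -> bool := fun=> false.

Definition computable (f : nat -> nat) : Prop := computable_in oracle0 f.

Definition turing_le (A X : nat -> bool) : Prop :=
  computable_in X (fun n => A n : nat).

Definition halts (X : nat -> bool) (e x : nat) : Prop :=
  exists s, run X s (decode e) x != None.

Definition jump (X : nat -> bool) : nat -> bool := fun e => `[< halts X e e >].

Definition W (e : nat) : set nat := [set x | halts oracle0 e x].

(* As usual, only numbers below s may have entered W_e by stage s; so each    *)
(* W_{e,s} is finite and W_{e,0} is empty.                                    *)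
Definition W_at (e s : nat) : set nat :=
  [set x | (x < s) && (run oracle0 s (decode e) x != None)].

Lemma W_bigcup e : W e = \bigcup_s W_at e s.
Proof.
apply/seteqP; split => x.
  move=> [s]; case E: run => [y|] // _; exists (maxn s x.+1) => //.
  by apply/andP; split; rewrite ?leq_maxr ?(run_mono (leq_maxl _ _) E).
by move=> [s _ /andP[_ ?]]; exists s.
Qed.

(* The finite set with canonical index u, i.e. u is the sum of the 2^x for x  *)
(* in the set.                                                                *)
Definition canonical_set (u : nat) : set nat := [set x | odd (u %/ 2 ^ x)].

(* The value of the binary numeral 1sigma, minus 1: a bijection between       *)
(* binary strings and numbers.                                                *)
Definition string_code (sigma : seq bool) : nat :=
  (foldl (fun k (b : bool) => b + k.*2) 1 sigma).-1.

(* The truth table with index <q, u> asks the oracle the finite list of       *)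
(* queries coded by q, and accepts iff the code of the list of answers is in  *)
(* the finite set with canonical index u.                                     *)
Definition tt_sat (X : nat -> bool) (t : nat) : Prop :=
  let: (q, u) := Cantor.of_nat t in
  canonical_set u (string_code (map X (CodeSeq.decode q))).

Definition tt_le (A X : nat -> bool) : Prop :=
  exists2 f : nat -> nat, computable f & forall n, A n <-> tt_sat X (f n).

Definition superhigh (Z : nat -> bool) : Prop :=
  tt_le (jump (jump oracle0)) (jump Z).

Definition ce (A : nat -> bool) : Prop := exists e, [set` A] = W e.

(* A computable sequence of finite sets is given by canonical indices. *)
Definition computable_enumeration (A : nat -> bool) (a : nat -> nat) : Prop :=
  [/\ computable a,
      forall s, canonical_set (a s) `<=` canonical_set (a s.+1)
    & [set` A] = \bigcup_s canonical_set (a s)].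

(* For s = 0 the set W_{e,s} is empty, so the value of s.-1 is irrelevant. *)
Definition promptly_simple (A : nat -> bool) : Prop :=
  [/\ ce A,
      infinite_set (~` [set` A])
    & exists p a : nat -> nat,
      [/\ computable p,
          computable_enumeration A a
        & forall e, infinite_set (W e) ->
          exists s x, (W_at e s `\` W_at e s.-1) x /\
                      canonical_set (a (p s)) x]].

Definition cylinder (sigma : seq bool) : set (nat -> bool) :=
  [set X | mkseq X (size sigma) = sigma].

Lemma cylinder_nil : cylinder [::] = setT.
Proof. exact/seteqP. Qed.

Lemma cylinder_rcons sigma b :
  cylinder (rcons sigma b) = cylinder sigma `&` [set X | X (size sigma) = b].
Proof.
apply/seteqP; split=> X; rewrite /cylinder/= size_rcons mkseqS.
  by move=> /rcons_inj[-> ->].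
by move=> [-> ->].
Qed.

Notation coin_space := (g_sigma_algebraType (range cylinder)).

Section fair_coin.
Variable R : realType.
Local Open Scope ring_scope.

Definition binary_digits (x : R) : coin_space :=
  fun n => odd (Num.truncn (x * 2 ^+ n.+1)).

(* The image under binary expansion of Lebesgue measure on [0, 1[. *)
Definition fair_coin : set coin_space -> \bar R :=
  pushforward (mrestr lebesgue_measure (measurable_itv `[0, 1[%R))
    (binary_digits : measurableTypeR R -> coin_space).

Lemma truncn_preimage (c : R) (k : nat) : (0 < c) -> (0 < k)%N ->
  [set x : R | Num.truncn (x * c) = k] = `[k%:R / c, k.+1%:R / c[%classic.
Proof.
move=> c0 k0; apply/seteqP; split=> x /=; rewrite in_itv/=.
  move=> xk; have x0 : 0 <= x * c.
    by rewrite leNgt; apply/negP => /ltW x0; move: k0; rewrite -xk;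
      rewrite truncn_gt0 leNgt (le_lt_trans x0).
  have := truncn_itv x0; rewrite xk => /andP[h1 h2].
  by rewrite ler_pdivrMr// h1 ltr_pdivlMr.
by rewrite ler_pdivrMr// ltr_pdivlMr// => h; apply: truncn_def.
Qed.

Lemma measurable_binary_digit (n : nat) (b : bool) :
  measurable [set x : measurableTypeR R | binary_digits x n = b].
Proof.
wlog -> : b / b = true.
  move=> H; case: b; first exact: H.
  have -> : [set x : measurableTypeR R | binary_digits x n = false] =
            ~` [set x | binary_digits x n = true].
    by apply/seteqP; split=> x /=; [move=> ->|move/negP/negbTE].
  by apply: measurableC; exact: H.
have -> : [set x : measurableTypeR R | binary_digits x n = true] =
  \bigcup_(k in [set k | odd k]) [set x | Num.truncn (x * 2 ^+ n.+1) = k].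
  apply/seteqP; split=> x /=; first by move=> xn; eexists; [exact: xn|].
  by move=> [k /= ok xk]; rewrite /binary_digits xk.
apply: bigcup_measurable => k /= ok.
by rewrite truncn_preimage ?exprn_gt0 ?odd_gt0.
Qed.

Lemma measurable_binary_digits :
  measurable_fun [set: measurableTypeR R] binary_digits.
Proof.
apply: (@measurability _ _ (measurableTypeR R) coin_space setT binary_digits
  (range cylinder)) => //.
move=> _ [_ [sigma _ <-] <-]; rewrite setTI.
elim/last_ind: sigma => [|sigma b IH].
  by rewrite cylinder_nil preimage_setT; exact: measurableT.
rewrite cylinder_rcons preimage_setI; apply: measurableI => //.
exact: measurable_binary_digit.
Qed.

Lemma truncn_double (y : R) : 0 <= y ->
  Num.truncn (y * 2) = (odd (Num.truncn (y * 2)) + (Num.truncn y).*2)%N.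
Proof.
move=> y0; rewrite -[LHS]odd_double_half; congr (_ + _.*2)%N.
apply/esym/truncn_def.
have /andP[] := @truncn_itv R (y * 2) (mulr_ge0 y0 (ler0n _ 2)).
set t := Num.truncn _.
have -> : t%:R = (odd t)%:R + 2 * t./2%:R :> R.
  by rewrite -natrM -natrD mul2n odd_double_half.
rewrite -[t.+1%:R]natr1 -[_./2.+1%:R]natr1.
have -> : t%:R = (odd t)%:R + 2 * t./2%:R :> R.
  by rewrite -natrM -natrD mul2n odd_double_half.
have : (0 : R) <= (odd t)%:R <= (1 : R) by rewrite ler0n lern1 leq_b1.
by move=> /andP[h3 h4] h1 h2; apply/andP; split; lra.
Qed.

Definition string_value (sigma : seq bool) : nat :=
  foldl (fun k (b : bool) => (b + k.*2)%N) 0%N sigma.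

Lemma cylinder_truncn sigma (x : R) : 0 <= x < 1 ->
  cylinder sigma (binary_digits x) <->
  Num.truncn (x * 2 ^+ size sigma) = string_value sigma.
Proof.
move=> /andP[x0 x1]; elim/last_ind: sigma => [|sigma b IH].
  rewrite cylinder_nil mulr1; split=> // _; apply: truncn_def.
  by rewrite x0 x1.
have xs0 : 0 <= x * 2 ^+ size sigma by rewrite mulr_ge0// exprn_ge0.
have := truncn_double xs0; rewrite -mulrA -exprSr => E.
rewrite cylinder_rcons size_rcons /string_value foldl_rcons -/(string_value _).
split=> [[/IH sx]|].
  by rewrite /binary_digits /= => bE; rewrite E sx bE.
rewrite /= /binary_digits => E2.
have oE : odd (Num.truncn (x * 2 ^+ (size sigma).+1)) = b.
  by rewrite E2 oddD oddb odd_double addbF.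
split=> //; apply/IH; move: E; rewrite E2 oddD oddb odd_double addbF.
by move=> /addnI/double_inj.
Qed.

Let fair_coin0 : fair_coin set0 = 0%E.
Proof. by apply: measure0; exact: measurable_binary_digits. Qed.

Let fair_coin_ge0 A : (0 <= fair_coin A)%E.
Proof. by apply: measure_ge0; exact: measurable_binary_digits. Qed.

Let fair_coin_sigma_additive : semi_sigma_additive fair_coin.
Proof.
by apply: measure_semi_sigma_additive; exact: measurable_binary_digits.
Qed.

HB.instance Definition _ := isMeasure.Build _ _ _ fair_coin
  fair_coin0 fair_coin_ge0 fair_coin_sigma_additive.

Lemma fair_coin_cylinder sigma :
  fair_coin (cylinder sigma) = (2 ^- size sigma)%:E.
Proof.
set c : R := 2 ^+ size sigma; have c0 : 0 < c by rewrite exprn_gt0.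
set v := string_value sigma.
have vc : v.+1%:R <= c.
  rewrite /c /v -natrX ler_nat; elim/last_ind: (sigma) => // s b IH.
  rewrite /string_value foldl_rcons size_rcons expnS -/(string_value _).
  by case: b => /=; lia.
rewrite /fair_coin /pushforward /mrestr.
have -> : binary_digits @^-1` cylinder sigma `&` `[0, 1[%classic =
          `[v%:R / c, v.+1%:R / c[%classic.
  apply/seteqP; split=> x /=; rewrite !in_itv/=.
    move=> [/[swap] x01 /(cylinder_truncn _ x01) xv].
    have xc0 : 0 <= x * c by rewrite mulr_ge0 ?(ltW c0)//; case/andP: x01.
    by rewrite ler_pdivrMr// ltr_pdivlMr// /v -xv truncn_itv.
  rewrite ler_pdivrMr// ltr_pdivlMr// => vx.
  have x01 : 0 <= x < 1.
    case/andP: vx => h1 h2; apply/andP; split.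
      by rewrite -(pmulr_lge0 _ c0) (le_trans _ h1).
    by rewrite -(ltr_pM2r c0) mul1r (lt_le_trans h2).
  by split=> //; apply/(cylinder_truncn _ x01); exact: truncn_def.
rewrite lebesgue_measure_itv /= lte_fin ltr_pM2r ?invr_gt0// ltr_nat ltnSn.
by rewrite -EFinB -mulrBl -natr1 addrAC subrr add0r mul1r.
Qed.

Lemma fair_coin_setT : fair_coin [set: coin_space] = 1%:E.
Proof. by rewrite -cylinder_nil fair_coin_cylinder expr0 invr1. Qed.

HB.instance Definition _ := Measure_isProbability.Build _ _ _ fair_coin
  fair_coin_setT.

Definition ml_test (G : nat -> set coin_space) : Prop :=
  (exists e, forall m,
     G m = \bigcup_(sigma in
       [set sigma | W e (pair_code m (string_code sigma))]) cylinder sigma) /\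
  (forall m, (fair_coin (G m) <= (2 ^- m)%:E)%E).

Definition ml_random (Z : nat -> bool) : Prop :=
  forall G, ml_test G -> ~ (\bigcap_m G m) Z.

End fair_coin.

(* Main.v *)
(* Fix a truth-table reduction Phi. For each j take a block of j + 1 questions
   about a Delta_2 set, which is Turing and hence (as a Sigma_2 set) many-one
   reducible to the second jump of 0. Predict that the answers computed by Phi
   from the jump of the oracle form a vector that is at present given by at most
   the 2^-(j+1)-th part of all oracles, and replace the prediction as soon as it
   has been met, at some stage since it was made, by more than the 2^-j-th part.
   A truth table asks a fixed finite number of questions to a jump, each of which
   changes its answer at most once along an oracle, so the prediction changes
   only finitely often. Let the Delta_2 set have the predicted answers. If Phi
   reduces it to the jump of Z, then Z belongs, for every j, to the open class of
   measure at most 2^-j of the oracles that meet the current prediction.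

   Let A take a number x from W_j at stage s only if the current predictions in
   block j of the first j + 1 reductions have not changed since stage x. When x
   enters A at a stage u after Z has been seen, at a stage between x and u, to
   meet the prediction of block j for Phi, the class of block j at stage u contains
   Z. These classes form a Martin-Loef test, so for random Z this happens for
   finitely many j only, and Z computes A by waiting until it meets the
   predictions. *)
From HB Require Import structures.
From Stdlib Require Cantor.
From mathcomp Require Import all_boot all_order all_algebra.
From mathcomp Require Import all_classical all_reals all_analysis.
From mathcomp Require Import zify.
Require Import Defs.

Set Implicit Arguments.
Unset Strict Implicit.
Unset Printing Implicit Defensive.

Import Order.TTheory GRing.Theory Num.Theory.

Local Open Scope classical_set_scope.

(** * Closure properties of computable functions *)

Lemma of_pair_code x y : Cantor.of_nat (pair_code x y) = (x, y).
Proof. exact: Cantor.cancel_of_to. Qed.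

Lemma pair_of_nat n : pair_code (Cantor.of_nat n).1 (Cantor.of_nat n).2 = n.
Proof. by rewrite -surjective_pairing Cantor.cancel_to_of. Qed.

Lemma pair_code_inj x y x' y' :
  pair_code x y = pair_code x' y' -> (x, y) = (x', y').
Proof. by move=> E; rewrite -[LHS]of_pair_code E of_pair_code. Qed.

Definition eval X c x y := exists s, run X s c x = Some y.

Lemma eval_inj X c x y z : eval X c x y -> eval X c x z -> y = z.
Proof.
move=> [s Hs] [t Ht]; apply: Some_inj.
by rewrite -(run_mono (leq_maxl s t) Hs) (run_mono (leq_maxr s t) Ht).
Qed.

Lemma eval_pair X f g x y z :
  eval X f x y -> eval X g x z -> eval X (PPair f g) x (pair_code y z).
Proof.
move=> [s Hs] [t Ht]; exists (maxn s t).+1 => /=.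
by rewrite (run_mono (leq_maxl s t) Hs) (run_mono (leq_maxr s t) Ht).
Qed.

Lemma eval_comp X f g x y z :
  eval X g x y -> eval X f y z -> eval X (PComp f g) x z.
Proof.
move=> [s Hs] [t Ht]; exists (maxn s t).+1 => /=.
by rewrite (run_mono (leq_maxl s t) Hs) /= (run_mono (leq_maxr s t) Ht).
Qed.

Lemma eval_compE X f g x z :
  eval X (PComp f g) x z -> exists2 y, eval X g x y & eval X f y z.
Proof.
move=> [[|s]] //=; case Eg: (run X s g x) => [y|] //= Ef.
by exists y; exists s.
Qed.

Lemma eval_rec0 X f g a y :
  eval X f a y -> eval X (PRec f g) (pair_code a 0) y.
Proof. by move=> [s Hs]; exists s.+1 => /=; rewrite of_pair_code. Qed.

Lemma eval_recS X f g a n r y :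
  eval X (PRec f g) (pair_code a n) r ->
  eval X g (pair_code a (pair_code n r)) y ->
  eval X (PRec f g) (pair_code a n.+1) y.
Proof.
move=> [s Hs] [t Ht]; exists (maxn s t).+1; rewrite [LHS]/= of_pair_code.
by rewrite (run_mono (leq_maxl s t) Hs) /= (run_mono (leq_maxr s t) Ht).
Qed.

Lemma eval_min X f a m k :
  eval X f (pair_code a (m + k)) 0 ->
  (forall i, i < k -> exists y, eval X f (pair_code a (m + i)) y.+1) ->
  eval X (PMin f) (pair_code a m) (m + k).
Proof.
elim: k m => [|k IH] m.
  rewrite addn0 => -[s Hs] _; exists s.+1.
  by rewrite [LHS]/= of_pair_code Hs eqxx.
rewrite addnS -addSn => H0 Hi.
have [|s Hs] := IH _ H0; first by move=> i ik; rewrite addSnnS; exact: Hi.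
have [//|y [t Ht]] := Hi 0; rewrite addn0 in Ht.
exists (maxn s t).+1; rewrite [LHS]/= of_pair_code.
by rewrite (run_mono (leq_maxr s t) Ht) /= (run_mono (leq_maxl s t) Hs).
Qed.

Lemma run_PMin X f s a m n : run X s (PMin f) (pair_code a m) = Some n ->
  run X s f (pair_code a n) = Some 0.
Proof.
elim: s m => [|s IH] // m; rewrite [LHS]/= of_pair_code.
case E: (run X s f _) => [y|] //; case: eqP => [y0 [<-]|_ /IH].
  by rewrite (run_mono (leqnSn _) E) y0.
exact: run_mono.
Qed.

Class code (A : Type) := Code { enc : A -> nat; enc_inj : injective enc }.
Arguments enc : simpl never.

#[global] Instance code_nat : code nat := {| enc := id; enc_inj := @inj_id nat |}.

Lemma nat_of_bool_inj : injective nat_of_bool. Proof. by case; case. Qed.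
#[global] Instance code_bool : code bool := Code nat_of_bool_inj.

Section code_instances.
Context {A B : Type} {cA : code A} {cB : code B}.

Definition enc_pair (p : A * B) := pair_code (enc p.1) (enc p.2).
Lemma enc_pair_inj : injective enc_pair.
Proof.
by case=> a b [a' b'] /pair_code_inj [] E F; rewrite (enc_inj E) (enc_inj F).
Qed.

Definition enc_option (o : option A) := if o is Some a then (enc a).+1 else 0.
Lemma enc_option_inj : injective enc_option.
Proof. by case=> [a|] [b|] //=; case=> E; rewrite (enc_inj E). Qed.

Fixpoint enc_seq (l : seq A) :=
  if l is x :: l' then (pair_code (enc x) (enc_seq l')).+1 else 0.
Lemma enc_seq_inj : injective enc_seq.
Proof.
elim=> [|x l IH] [|y l'] //=; case=> /pair_code_inj [] E F.
by rewrite (enc_inj E) (IH _ F).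
Qed.

End code_instances.

#[global] Instance code_pair A B {cA : code A} {cB : code B} : code (A * B) :=
  Code enc_pair_inj.
#[global] Instance code_option A {cA : code A} : code (option A) :=
  Code enc_option_inj.
#[global] Instance code_seq A {cA : code A} : code (seq A) :=
  Code enc_seq_inj.

(** Passing to codes lets one notion cover all data types used below. Its closure properties become
    hints, and [calc_auto] proves computability by following the syntax of a function. *)
Definition calc (X : nat -> bool) A B {cA : code A} {cB : code B} (f : A -> B) :=
  exists c, forall a, eval X c (enc a) (enc (f a)).

Section calc_basic.
Variable X : nat -> bool.
Context {A B C D : Type}.
Context {cA : code A} {cB : code B} {cC : code C} {cD : code D}.

Lemma calc_ext (f g : A -> B) : f =1 g -> calc X f -> calc X g.
Proof. by move=> fg [c H]; exists c => a; rewrite -fg. Qed.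

Lemma calc_comp (g : B -> C) (f : A -> B) :
  calc X g -> calc X f -> calc X (fun a => g (f a)).
Proof.
by move=> [c H] [d K]; exists (PComp c d) => a; exact: eval_comp (K a) (H _).
Qed.

Lemma calc_pair (f : A -> B) (g : A -> C) :
  calc X f -> calc X g -> calc X (fun a => (f a, g a)).
Proof.
by move=> [c H] [d K]; exists (PPair c d) => a; exact: eval_pair.
Qed.

Lemma calc_fst (f : A -> B * C) : calc X f -> calc X (fun a => (f a).1).
Proof.
move=> [c H]; exists (PComp PFst c) => a; apply: eval_comp (H a) _.
by exists 1; rewrite /= of_pair_code.
Qed.

Lemma calc_snd (f : A -> B * C) : calc X f -> calc X (fun a => (f a).2).
Proof.
move=> [c H]; exists (PComp PSnd c) => a; apply: eval_comp (H a) _.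
by exists 1; rewrite /= of_pair_code.
Qed.

Lemma calc_id : calc X (fun a : A => a).
Proof.
(* No instruction is the identity, but unpairing and pairing again is, since the pairing is a
   bijection. *)
exists (PPair PFst PSnd) => a; exists 2 => /=.
by rewrite pair_of_nat.
Qed.

Lemma calc_succ (f : A -> nat) : calc X f -> calc X (fun a => (f a).+1).
Proof.
by move=> [c H]; exists (PComp PSucc c) => a; apply: eval_comp (H a) _; exists 1.
Qed.

Lemma calc_const (b : B) : calc X (fun _ : A => b).
Proof.
have H n : exists c, forall x, eval X c x n; last first.
  by have [c H'] := H (enc b); exists c => a.
elim: n => [|n [c H]]; first by exists PZero => x; exists 1.
by exists (PComp PSucc c) => x; apply: eval_comp (H x) _; exists 1.
Qed.

End calc_basic.

Lemma calc_enc X A B {cA : code A} {cB : code B} (f : A -> B) :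
  calc X f -> calc X (fun a => enc (f a)).
Proof. by []. Qed.

Section calc_rec.
Variable X : nat -> bool.
Context {A B C D : Type}.
Context {cA : code A} {cB : code B} {cC : code C} {cD : code D}.

Lemma calc_nat_rect (n : A -> nat) (f : A -> B) (g : A -> nat -> B -> B) :
  calc X (fun p : A * nat * B => g p.1.1 p.1.2 p.2) ->
  calc X f -> calc X n ->
  calc X (fun a => nat_rect (fun _ => B) (f a) (g a) (n a)).
Proof.
move=> Hg [cf Hf] [cn Hn].
have [cg {}Hg] : calc X (fun p : A * (nat * B) => g p.1 p.2.1 p.2.2).
  apply: (calc_comp (f := fun p : A * (nat * B) => (p.1, p.2.1, p.2.2)) Hg).
  apply: calc_pair; last by do 2! apply: calc_snd; exact: calc_id.
  apply: calc_pair; first by apply: calc_fst; exact: calc_id.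
  by apply: calc_fst; apply: calc_snd; exact: calc_id.
exists (PComp (PRec cf cg) (PPair (PPair PFst PSnd) cn)) => a.
apply: eval_comp.
  apply: eval_pair (Hn a); exists 2 => /=; first by rewrite pair_of_nat.
elim: (n a) => [|m IH] /=; first exact: eval_rec0.
exact: eval_recS IH (Hg (a, (m, _))).
Qed.

Lemma calc_if (b : A -> bool) (f g : A -> B) :
  calc X b -> calc X f -> calc X g -> calc X (fun a => if b a then f a else g a).
Proof.
move=> [cb Hb] Hf Hg.
(* The code of a boolean is 0 or 1, so the case distinction is a recursion of at most one step. *)
have : calc X (fun a => nat_rect (fun _ => B) (g a) (fun _ _ => f a) (b a));
    last first.
  by apply: calc_ext => a; case: (b a).
apply: calc_nat_rect => //; last by exists cb.
by apply: calc_comp Hf _; do 2! apply: calc_fst; exact: calc_id.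
Qed.

Lemma calc_nat_case (n : A -> nat) (f : A -> B) (g : A -> nat -> B) :
  calc X (fun p : A * nat => g p.1 p.2) -> calc X f -> calc X n ->
  calc X (fun a => if n a is m.+1 then g a m else f a).
Proof.
move=> Hg Hf Hn.
have : calc X (fun a => nat_rect (fun _ => B) (f a) (fun m _ => g a m) (n a));
    last first.
  by apply: calc_ext => a; case: (n a).
apply: calc_nat_rect => //.
apply: (calc_comp (f := fun p : A * nat * B => p.1) Hg).
by apply: calc_fst; exact: calc_id.
Qed.

End calc_rec.

(* Testing for 0 and taking predecessors on the codes evaluates [g] only on
   codes of elements of [D]. *)
Lemma calc_code_case X A B C D {cA : code A} {cB : code B} {cC : code C}
    {cD : code D} (sel : C -> option D)
    (o : A -> C) (f : A -> B) (g : A -> D -> B) :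
  (forall c, enc c = if sel c is Some d then (enc d).+1 else 0) ->
  calc X (fun p : A * D => g p.1 p.2) -> calc X f -> calc X o ->
  calc X (fun a => if sel (o a) is Some d then g a d else f a).
Proof.
move=> Hsel [cg Hg] [cf Hf] [co Ho].
have [cp Hp] : calc X predn.
  apply: (@calc_ext _ _ _ _ _ (fun n => if n is m.+1 then m else 0)).
    by case.
  apply: calc_nat_case; [|exact: calc_const|exact: calc_id].
  by apply: calc_snd; exact: calc_id.
have [ct Ht] : calc X (fun n : nat => n != 0).
  apply: (@calc_ext _ _ _ _ _ (fun n => if n is m.+1 then true else false)).
    by case.
  by apply: calc_nat_case; [exact: calc_const|exact: calc_const|exact: calc_id].
(* The recursion has length 0 or 1, depending on whether the code of [o a] is 0. Its only step
   discards the recursive value and keeps the pair of [a] and the predecessor. *)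
pose r := PRec (PComp cf PFst) (PComp cg PFst).
exists (PComp r (PPair (PPair (PPair PFst PSnd) (PComp cp co)) (PComp ct co))).
move=> a; apply: eval_comp.
  apply: eval_pair; last exact: eval_comp (Ho a) (Ht _).
  apply: eval_pair; last exact: eval_comp (Ho a) (Hp _).
  by exists 2; rewrite /= pair_of_nat.
have H0 z : eval X r (pair_code (pair_code (enc a) z) 0) (enc (f a)).
  apply: eval_rec0; apply: eval_comp (Hf a).
  by exists 1; rewrite /= of_pair_code.
rewrite [enc (_ != 0)]/enc /= Hsel; case: (sel (o a)) => [d|] //=.
apply: eval_recS (H0 _) _; apply: eval_comp (Hg (a, d)).
by exists 1; rewrite /= of_pair_code.
Qed.

Lemma calc_ocase X A B C {cA : code A} {cB : code B} {cC : code C}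
    (o : A -> option C) (f : A -> B) (g : A -> C -> B) :
  calc X (fun p : A * C => g p.1 p.2) -> calc X f -> calc X o ->
  calc X (fun a => if o a is Some d then g a d else f a).
Proof. by move=> Hg Hf Ho; apply: (calc_code_case (sel := id) _ Hg Hf Ho); case. Qed.

Lemma calc_seq_case X A B C {cA : code A} {cB : code B} {cC : code C}
    (l : A -> seq C) (f : A -> B) (g : A -> C -> seq C -> B) :
  calc X (fun p : A * C * seq C => g p.1.1 p.1.2 p.2) -> calc X f -> calc X l ->
  calc X (fun a => if l a is x :: l' then g a x l' else f a).
Proof.
move=> Hg Hf Hl.
pose sel (l : seq C) := if l is x :: l' then Some (x, l') else None.
have : calc X (fun a => if sel (l a) is Some p then g a p.1 p.2 else f a);
    last first.
  by apply: calc_ext => a; rewrite /sel; case: (l a).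
apply: (calc_code_case (sel := sel) _ _ Hf Hl); first by case.
apply: (calc_comp (f := fun p : A * (C * seq C) => (p.1, p.2.1, p.2.2)) Hg).
apply: calc_pair; last by do 2! apply: calc_snd; exact: calc_id.
apply: calc_pair; first by apply: calc_fst; exact: calc_id.
by apply: calc_fst; apply: calc_snd; exact: calc_id.
Qed.

Lemma calc_Some X A B {cA : code A} {cB : code B} (f : A -> B) :
  calc X f -> calc X (fun a => Some (f a)).
Proof. exact: calc_succ. Qed.

Lemma calc_cons X A B {cA : code A} {cB : code B} (f : A -> B) (l : A -> seq B) :
  calc X f -> calc X l -> calc X (fun a => f a :: l a).
Proof. by move=> Hf Hl; apply: calc_succ; exact: (calc_pair Hf Hl). Qed.

Create HintDb calc discriminated.
#[global] Hint Constants Opaque : calc.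
#[global] Hint Variables Opaque : calc.
#[global] Hint Resolve calc_const calc_id | 0 : calc.
#[global] Hint Resolve calc_fst calc_snd calc_pair calc_succ calc_Some
  calc_cons : calc.
#[global] Hint Resolve calc_nat_rect calc_if calc_nat_case calc_ocase
  calc_seq_case : calc.

(* Unification eta-contracts the functions it finds. *)
#[global] Hint Extern 1 (@calc ?X ?A ?B ?cA ?cB ?f) =>
  lazymatch f with
  | fun _ => _ => fail
  | _ => change (@calc X A B cA cB (fun a => f a))
  end : calc.

#[global] Hint Extern 2 (calc _ _) =>
  match goal with
  | H : @calc _ _ _ _ _ ?f |- @calc _ _ _ _ _ (fun a => ?f (@?g a)) =>
    refine (calc_comp (f := g) H _)
  end : calc.

Ltac calc_auto := typeclasses eauto with calc.

(** * Boolean operations and arithmetic *)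

Lemma calc_negb X A {cA : code A} (b : A -> bool) :
  calc X b -> calc X (fun a => ~~ b a).
Proof. by move=> Hb; apply: (calc_if Hb); exact: calc_const. Qed.

Lemma calc_andb X A {cA : code A} (b c : A -> bool) :
  calc X b -> calc X c -> calc X (fun a => b a && c a).
Proof. by move=> Hb Hc; apply: (calc_if Hb Hc); exact: calc_const. Qed.

Lemma calc_orb X A {cA : code A} (b c : A -> bool) :
  calc X b -> calc X c -> calc X (fun a => b a || c a).
Proof. by move=> Hb Hc; apply: (calc_if Hb _ Hc); exact: calc_const. Qed.

Lemma calc_nat_of_bool X A {cA : code A} (b : A -> bool) :
  calc X b -> calc X (fun a => nat_of_bool (b a)).
Proof. by []. Qed.

#[local] Hint Resolve calc_negb calc_andb calc_orb calc_nat_of_bool : calc.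

Lemma calc_pred X A {cA : code A} (f : A -> nat) :
  calc X f -> calc X (fun a => (f a).-1).
Proof.
move=> Hf; apply: (@calc_ext _ _ _ _ _ (fun a => if f a is m.+1 then m else 0)).
  by move=> a; case: (f a).
calc_auto.
Qed.
#[local] Hint Resolve calc_pred : calc.

Lemma calc_add X A {cA : code A} (f g : A -> nat) :
  calc X f -> calc X g -> calc X (fun a => f a + g a).
Proof.
move=> Hf Hg.
apply: (@calc_ext _ _ _ _ _
  (fun a => nat_rect (fun=> nat) (f a) (fun _ r => r.+1) (g a))).
  by move=> a; elim: (g a) => [|m /= ->]; rewrite ?addn0 ?addnS.
calc_auto.
Qed.
#[local] Hint Resolve calc_add : calc.

Lemma calc_sub X A {cA : code A} (f g : A -> nat) :
  calc X f -> calc X g -> calc X (fun a => f a - g a).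
Proof.
move=> Hf Hg.
apply: (@calc_ext _ _ _ _ _
  (fun a => nat_rect (fun=> nat) (f a) (fun _ r => r.-1) (g a))).
  by move=> a; elim: (g a) => [|m /= ->]; rewrite ?subn0 ?subnS.
calc_auto.
Qed.
#[local] Hint Resolve calc_sub : calc.

Lemma calc_mul X A {cA : code A} (f g : A -> nat) :
  calc X f -> calc X g -> calc X (fun a => f a * g a).
Proof.
move=> Hf Hg.
apply: (@calc_ext _ _ _ _ _
  (fun a => nat_rect (fun=> nat) 0 (fun _ r => r + f a) (g a))).
  by move=> a; elim: (g a) => [|m /= ->]; rewrite ?muln0 ?mulnSr.
calc_auto.
Qed.
#[local] Hint Resolve calc_mul : calc.

Lemma calc_exp X A {cA : code A} (f g : A -> nat) :
  calc X f -> calc X g -> calc X (fun a => f a ^ g a).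
Proof.
move=> Hf Hg.
apply: (@calc_ext _ _ _ _ _
  (fun a => nat_rect (fun=> nat) 1 (fun _ r => f a * r) (g a))).
  by move=> a; elim: (g a) => [|m /= ->] //; rewrite expnS.
calc_auto.
Qed.
#[local] Hint Resolve calc_exp : calc.

Lemma calc_double X A {cA : code A} (f : A -> nat) :
  calc X f -> calc X (fun a => (f a).*2).
Proof.
move=> Hf; apply: (@calc_ext _ _ _ _ _ (fun a => f a + f a)); last by calc_auto.
by move=> a; lia.
Qed.

Lemma calc_odd X A {cA : code A} (f : A -> nat) :
  calc X f -> calc X (fun a => odd (f a)).
Proof.
move=> Hf.
apply: (@calc_ext _ _ _ _ _
  (fun a => nat_rect (fun=> bool) false (fun _ r => ~~ r) (f a))).
  by move=> a; elim: (f a) => [|m /= ->].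
calc_auto.
Qed.

Lemma calc_eq0 X A {cA : code A} (f : A -> nat) :
  calc X f -> calc X (fun a => f a == 0).
Proof.
move=> Hf.
apply: (@calc_ext _ _ _ _ _ (fun a => if f a is m.+1 then false else true)).
  by move=> a; case: (f a).
calc_auto.
Qed.
#[local] Hint Resolve calc_eq0 : calc.

Lemma calc_leq X A {cA : code A} (f g : A -> nat) :
  calc X f -> calc X g -> calc X (fun a => f a <= g a).
Proof. by move=> Hf Hg; apply: calc_eq0; calc_auto. Qed.
#[local] Hint Resolve calc_leq : calc.

Lemma calc_eqn X A {cA : code A} (f g : A -> nat) :
  calc X f -> calc X g -> calc X (fun a => f a == g a).
Proof.
move=> Hf Hg.
apply: (@calc_ext _ _ _ _ _ (fun a => (f a <= g a) && (g a <= f a))).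
  by move=> a; lia.
calc_auto.
Qed.

(** The recursion keeps the last [k] with [g a * k <= f a]; after [n] steps its value is the minimum
    of [n] and the quotient, and [f a] steps are enough. *)
Lemma calc_divn X A {cA : code A} (f g : A -> nat) :
  calc X f -> calc X g -> calc X (fun a => f a %/ g a).
Proof.
move=> Hf Hg.
apply: (@calc_ext _ _ _ _ _ (fun a => if g a == 0 then 0 else
  nat_rect (fun=> nat) 0 (fun k r => if g a * k.+1 <= f a then k.+1 else r) (f a))).
  move=> a; case: eqP => [->|g0]; first by rewrite divn0.
  have H n : nat_rect (fun=> nat) 0
      (fun k r => if g a * k.+1 <= f a then k.+1 else r) n = minn n (f a %/ g a).
    elim: n => [|n /= ->]; first by rewrite min0n.
    have : (g a * n.+1 <= f a) = (n.+1 <= f a %/ g a).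
      by rewrite leq_divRL ?lt0n; [rewrite mulnC|apply/eqP].
    by move=> ->; case: ifP; lia.
  by rewrite H (minn_idPr _) // leq_div.
calc_auto.
Qed.
#[local] Hint Resolve calc_divn : calc.

Lemma calc_modn X A {cA : code A} (f g : A -> nat) :
  calc X f -> calc X g -> calc X (fun a => f a %% g a).
Proof.
move=> Hf Hg; apply: (@calc_ext _ _ _ _ _ (fun a => f a - f a %/ g a * g a)).
  by move=> a; have := divn_eq (f a) (g a); lia.
calc_auto.
Qed.

#[global] Hint Resolve calc_negb calc_andb calc_orb calc_nat_of_bool
  calc_pred calc_add calc_sub calc_mul calc_exp calc_double calc_odd calc_leq
  calc_eqn calc_divn calc_modn : calc.

Lemma calc_of_nat X A {cA : code A} (f : A -> nat) :
  calc X f -> calc X (fun a => Cantor.of_nat (f a)).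
Proof.
move=> [c H]; exists c => a.
by rewrite [enc (Cantor.of_nat _)]/enc /= /enc_pair pair_of_nat.
Qed.

Lemma calc_pair_code X A {cA : code A} (f g : A -> nat) :
  calc X f -> calc X g -> calc X (fun a => pair_code (f a) (g a)).
Proof. by move=> Hf Hg; exact: (calc_pair Hf Hg). Qed.

#[global] Hint Resolve calc_of_nat calc_pair_code : calc.

(** * Operations on lists *)

Section calc_seq.
Context (X : nat -> bool) {A B C : Type} {cA : code A} {cB : code B} {cC : code C}.
Implicit Types (l : A -> seq B).

Lemma size_enc_seq (s : seq B) : size s <= enc s.
Proof.
elim: s => //= x s IH.
have [_] := pair_code_ge (enc x) (enc s); rewrite /enc /=.
by move: IH; rewrite /enc /=; lia.
Qed.

Lemma calc_foldl (i : A -> C) (g : A -> C -> B -> C) l :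
  calc X (fun p : A * C * B => g p.1.1 p.1.2 p.2) -> calc X i -> calc X l ->
  calc X (fun a => foldl (g a) (i a) (l a)).
Proof.
move=> Hg Hi Hl.
pose step a (st : C * seq B) :=
  if st.2 is x :: l' then (g a st.1 x, l') else st.
apply: (@calc_ext _ _ _ _ _ (fun a =>
  (nat_rect (fun=> (C * seq B)%type) (i a, l a)
     (fun _ => step a) (enc (l a))).1)).
  move=> a; have := size_enc_seq (l a); move: (enc (l a)) => n.
  have E z m : nat_rect (fun=> (C * seq B)%type) z (fun _ => step a) m =
               iter m (step a) z by elim: m => //= m ->.
  rewrite {}E; elim: n (i a) (l a) => [|n IH] z [|x s] //.
    by rewrite iterSr /= => _; exact: IH.
  by rewrite iterSr /= => H; exact: IH.
apply: calc_fst; apply: calc_nat_rect; [|by calc_auto|exact: calc_enc].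
apply: calc_seq_case; [|calc_auto..].
apply: calc_pair; last by calc_auto.
apply: (calc_comp (f := fun p => (p.1.1.1.1, p.1.1.2.1, p.1.2)) Hg).
by calc_auto.
Qed.

End calc_seq.

#[global] Hint Resolve calc_foldl : calc.

Section calc_seq_ops.
Context (X : nat -> bool).

Lemma calc_catrev A B {cA : code A} {cB : code B} (l l' : A -> seq B) :
  calc X l -> calc X l' -> calc X (fun a => catrev (l a) (l' a)).
Proof.
move=> Hl Hl'.
apply: (@calc_ext _ _ _ _ _ (fun a => foldl (fun s x => x :: s) (l' a) (l a))).
  by move=> a; elim: (l a) (l' a) => [|x s IH] t //=.
calc_auto.
Qed.
#[local] Hint Resolve calc_catrev : calc.

Lemma calc_rev A B {cA : code A} {cB : code B} (l : A -> seq B) :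
  calc X l -> calc X (fun a => rev (l a)).
Proof. by move=> Hl; apply: calc_catrev => //; exact: calc_const. Qed.
#[local] Hint Resolve calc_rev : calc.

Lemma calc_cat A B {cA : code A} {cB : code B} (l l' : A -> seq B) :
  calc X l -> calc X l' -> calc X (fun a => l a ++ l' a).
Proof.
move=> Hl Hl'; apply: (@calc_ext _ _ _ _ _ (fun a => catrev (rev (l a)) (l' a))).
  by move=> a; rewrite catrevE revK.
calc_auto.
Qed.
#[local] Hint Resolve calc_cat : calc.

Lemma calc_rcons A B {cA : code A} {cB : code B} (l : A -> seq B) (f : A -> B) :
  calc X l -> calc X f -> calc X (fun a => rcons (l a) (f a)).
Proof.
move=> Hl Hf; apply: (@calc_ext _ _ _ _ _ (fun a => l a ++ [:: f a])).
  by move=> a; rewrite cats1.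
calc_auto.
Qed.
#[local] Hint Resolve calc_rcons : calc.

Lemma calc_map A B C {cA : code A} {cB : code B} {cC : code C}
    (f : A -> B -> C) (l : A -> seq B) :
  calc X (fun p : A * B => f p.1 p.2) -> calc X l ->
  calc X (fun a => map (f a) (l a)).
Proof.
move=> Hf Hl.
apply: (@calc_ext _ _ _ _ _
  (fun a => foldl (fun s x => rcons s (f a x)) [::] (l a))).
  move=> a; rewrite -[RHS]cat0s; elim: (l a) [::] => [|x s IH] t /=.
    by rewrite cats0.
  by rewrite IH cat_rcons.
apply: calc_foldl; [|calc_auto..].
apply: calc_rcons; [calc_auto|].
by apply: (calc_comp (f := fun p => (p.1.1, p.2)) Hf); calc_auto.
Qed.

Lemma calc_filter A B {cA : code A} {cB : code B}
    (f : A -> B -> bool) (l : A -> seq B) :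
  calc X (fun p : A * B => f p.1 p.2) -> calc X l ->
  calc X (fun a => seq.filter (f a) (l a)).
Proof.
move=> Hf Hl.
apply: (@calc_ext _ _ _ _ _
  (fun a => foldl (fun s x => if f a x then rcons s x else s) [::] (l a))).
  move=> a; rewrite -[RHS]cat0s; elim: (l a) [::] => [|x s IH] t /=.
    by rewrite cats0.
  by rewrite IH; case: ifP; rewrite ?cat_rcons.
apply: calc_foldl; [|calc_auto..].
apply: calc_if; [|calc_auto..].
by apply: (calc_comp (f := fun p => (p.1.1, p.2)) Hf); calc_auto.
Qed.

Lemma calc_has A B {cA : code A} {cB : code B}
    (f : A -> B -> bool) (l : A -> seq B) :
  calc X (fun p : A * B => f p.1 p.2) -> calc X l ->
  calc X (fun a => has (f a) (l a)).
Proof.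
move=> Hf Hl.
apply: (@calc_ext _ _ _ _ _
  (fun a => foldl (fun b x => b || f a x) false (l a))).
  move=> a; rewrite -[RHS]orFb; elim: (l a) false => [|x s IH] t /=.
    by rewrite orbF.
  by rewrite IH orbA.
apply: calc_foldl; [|calc_auto..].
apply: calc_orb; [calc_auto|].
by apply: (calc_comp (f := fun p => (p.1.1, p.2)) Hf); calc_auto.
Qed.

Lemma calc_all A B {cA : code A} {cB : code B}
    (f : A -> B -> bool) (l : A -> seq B) :
  calc X (fun p : A * B => f p.1 p.2) -> calc X l ->
  calc X (fun a => all (f a) (l a)).
Proof.
move=> Hf Hl.
apply: (@calc_ext _ _ _ _ _ (fun a => ~~ has (fun x => ~~ f a x) (l a))).
  by move=> a; rewrite has_predC negbK.
by apply: calc_negb; apply: calc_has => //; exact: calc_negb.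
Qed.

Lemma calc_size A B {cA : code A} {cB : code B} (l : A -> seq B) :
  calc X l -> calc X (fun a => size (l a)).
Proof.
move=> Hl.
apply: (@calc_ext _ _ _ _ _ (fun a => foldl (fun n _ => n.+1) 0 (l a))).
  move=> a; rewrite -[RHS]add0n; elim: (l a) 0 => [|x s IH] n /=.
    by rewrite addn0.
  by rewrite IH addSnnS.
calc_auto.
Qed.

Lemma calc_nth A B {cA : code A} {cB : code B} (x : A -> B) (l : A -> seq B)
    (n : A -> nat) :
  calc X x -> calc X l -> calc X n -> calc X (fun a => nth (x a) (l a) (n a)).
Proof.
move=> Hx Hl Hn; apply: (@calc_ext _ _ _ _ _ (fun a =>
   if nat_rect (fun=> seq B) (l a)
        (fun _ s => if s is y :: s' then s' else s) (n a)
   is y :: _ then y else x a)).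
  move=> a; elim: (n a) (l a) => [|m IH] [|y s] //.
    have -> // : nat_rect (fun=> seq B) [::]
      (fun _ s => if s is y :: s' then s' else s) m.+1 = [::].
    by elim: m.+1 {IH} => //= k ->.
  rewrite [RHS]/= -(IH s).
  have -> // : nat_rect (fun=> seq B) (y :: s)
     (fun _ s0 => if s0 is _ :: s' then s' else s0) m.+1 =
    nat_rect (fun=> seq B) s (fun _ s0 => if s0 is _ :: s' then s' else s0) m.
  by elim: m {IH} => //= m ->.
calc_auto.
Qed.

Lemma calc_iota A {cA : code A} (m n : A -> nat) :
  calc X m -> calc X n -> calc X (fun a => iota (m a) (n a)).
Proof.
move=> Hm Hn; apply: (@calc_ext _ _ _ _ _ (fun a =>
   nat_rect (fun=> seq nat) [::] (fun k s => rcons s (m a + k)) (n a))).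
  move=> a; elim: (n a) => // k IH.
  by rewrite [LHS]/= IH -cats1 -[in RHS]addn1 iotaD.
calc_auto.
Qed.
#[local] Hint Resolve calc_map calc_iota : calc.

Lemma calc_mkseq A B {cA : code A} {cB : code B} (f : A -> nat -> B)
    (n : A -> nat) :
  calc X (fun p : A * nat => f p.1 p.2) -> calc X n ->
  calc X (fun a => mkseq (f a) (n a)).
Proof. by move=> Hf Hn; apply: calc_map => //; calc_auto. Qed.

Lemma calc_flatten A B {cA : code A} {cB : code B} (l : A -> seq (seq B)) :
  calc X l -> calc X (fun a => flatten (l a)).
Proof.
move=> Hl; apply: (@calc_ext _ _ _ _ _ (fun a => foldl cat [::] (l a))).
  move=> a; rewrite -[RHS]cat0s; elim: (l a) [::] => [|x s IH] t /=.
    by rewrite cats0.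
  by rewrite IH catA.
calc_auto.
Qed.

End calc_seq_ops.

#[global] Hint Resolve calc_catrev calc_rev calc_cat calc_rcons calc_map
  calc_filter calc_has calc_all calc_size calc_nth calc_iota calc_mkseq
  calc_flatten : calc.

(** * Oracle queries, unbounded search and c.e. sets *)

Lemma calc_oracle (X : nat -> bool) A {cA : code A} (f : A -> nat) :
  calc X f -> calc X (fun a => X (f a)).
Proof.
move=> [c H]; exists (PComp POracle c) => a; apply: eval_comp (H a) _.
by exists 1.
Qed.

Lemma calc_search X A {cA : code A} (P : A -> nat -> bool) (f : A -> nat) :
  calc X (fun p : A * nat => P p.1 p.2) -> (forall a, P a (f a)) ->
  (forall a n, n < f a -> ~~ P a n) -> calc X f.
Proof.
(* [PMin] searches for the value 0, which codes [false]; hence the negation. *)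
move=> /calc_negb [c Hc] Pf Pmin.
exists (PComp (PMin c) (PPair (PPair PFst PSnd) PZero)) => a.
apply: eval_comp.
  by exists 3 => /=; rewrite pair_of_nat.
rewrite -[enc (f a)]add0n; apply: eval_min => [|i Hi].
  by have := Hc (a, f a); rewrite Pf.
by exists 0; have := Hc (a, i); rewrite /= Pmin.
Qed.

Lemma calc_computable X (f : nat -> nat) : calc X f -> computable_in X f.
Proof. by []. Qed.

Lemma evalP X c x : halts X (encode c) x <-> exists y, eval X c x y.
Proof.
rewrite /halts encodeK; split=> [[s]|[y [s E]]]; last by exists s; rewrite E.
by case E: run => [y|] // _; exists y, s.
Qed.

(** The program searches for a witness [n], so it converges on exactly those [x] that have one. *)
Lemma ce_of_calc X (P : nat -> nat -> bool) :
  calc X (fun p : nat * nat => P p.1 p.2) ->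
  exists e, forall x, halts X e x <-> exists n, P x n.
Proof.
move=> /calc_negb [c Hc].
exists (encode (PComp (PMin c) (PPair (PPair PFst PSnd) PZero))) => x.
have Hx : eval X (PPair (PPair PFst PSnd) PZero) x (pair_code x 0).
  by exists 3 => /=; rewrite pair_of_nat.
rewrite evalP; split=> [[y /eval_compE[z Hz [s Hs]]]|[n Pn]].
  move: Hs; rewrite -(eval_inj Hx Hz) => /run_PMin Hy; exists y.
  apply: contraT => nP; have := Hc (x, y); rewrite /= nP => Ht.
  by have := eval_inj (ex_intro _ _ Hy) Ht.
have [k Pk kmin] := ex_minnP (ex_intro _ n Pn).
exists k; apply: eval_comp Hx _.
rewrite -[k in eval _ _ _ k]add0n; apply: eval_min => [|i Hi].
  by have := Hc (x, k); rewrite /= Pk.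
exists 0; have := Hc (x, i); rewrite /=; case E: (P x i) => //.
by have := kmin _ E; lia.
Qed.

(** * A computable interpreter *)

(* [run] on codes of programs and for partial oracles; a query outside the
   domain of the oracle makes the computation diverge. *)
Fixpoint crun (O : nat -> option nat) (s e x : nat) {struct s} : option nat :=
  if s isn't s'.+1 then None else
  match e with
  | 0 => Some 0
  | 1 => Some x.+1
  | 2 => Some (Cantor.of_nat x).1
  | 3 => Some (Cantor.of_nat x).2
  | 4 => O x
  | e'.+4.+1 =>
      let q := e' %/ 4 in
      let f := (Cantor.of_nat q).1 in
      let g := (Cantor.of_nat q).2 in
      let a := (Cantor.of_nat x).1 in
      match e' %% 4 with
      | 0 => if crun O s' f x is Some y then
               if crun O s' g x is Some z then Some (pair_code y z) else None
             else None
      | 1 => if crun O s' g x is Some y then crun O s' f y else None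
      | 2 => if (Cantor.of_nat x).2 is m.+1 then
               if crun O s' e (pair_code a m) is Some y then
                 crun O s' g (pair_code a (pair_code m y))
               else None
             else crun O s' f a
      | _ => if crun O s' q x is Some y then
               if y == 0 then Some (Cantor.of_nat x).2
               else crun O s' e (pair_code a (Cantor.of_nat x).2.+1)
             else None
      end
  end.

Lemma crun_encode (X : nat -> bool) s c x :
  crun (fun n => Some (X n : nat)) s (encode c) x = run X s c x.
Proof.
have step n r : r < 4 -> (r + 4 * n) %/ 4 = n /\ (r + 4 * n) %% 4 = r.
  by move=> r4; split; lia.
elim: s c x => [|s IH] // c x.
case: c => // [f g|f g|f g|f].
- have [E1 E2] := step (pair_code (encode f) (encode g)) 0 isT.
  change (encode (PPair f g)) with
    ((0 + 4 * pair_code (encode f) (encode g)).+4.+1).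
  rewrite [LHS]/= -/muln E1 E2 !of_pair_code [RHS]/= !IH.
  by case: run => // y; case: run.
- have [E1 E2] := step (pair_code (encode f) (encode g)) 1 isT.
  change (encode (PComp f g)) with
    ((1 + 4 * pair_code (encode f) (encode g)).+4.+1).
  rewrite [LHS]/= -/muln E1 E2 !of_pair_code [RHS]/= !IH.
  by case: run => //= y; rewrite IH.
- have [E1 E2] := step (pair_code (encode f) (encode g)) 2 isT.
  have IHe := IH (PRec f g).
  change (encode (PRec f g)) with
    ((2 + 4 * pair_code (encode f) (encode g)).+4.+1) in IHe |- *.
  rewrite [LHS]/= -/muln E1 E2 !of_pair_code [RHS]/=.
  case: (Cantor.of_nat x) => a [|m] /=; rewrite ?IH ?IHe //.
  by case: run => //= y; rewrite IH.
- have [E1 E2] := step (encode f) 3 isT.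
  have IHe := IH (PMin f).
  change (encode (PMin f)) with ((3 + 4 * encode f).+4.+1) in IHe |- *.
  rewrite [LHS]/= -/muln E1 E2 [RHS]/= !IH.
  case: (Cantor.of_nat x) => a m /=.
  by case: run => // y; case: ifP => // _; exact: IHe.
Qed.

Lemma crun_decode (X : nat -> bool) s e x :
  crun (fun n => Some (X n : nat)) s e x = run X s (decode e) x.
Proof. by rewrite -crun_encode decodeK. Qed.

Lemma crun_mono O O' s s' e x y :
  (forall n z, O n = Some z -> O' n = Some z) ->
  s <= s' -> crun O s e x = Some y -> crun O' s' e x = Some y.
Proof.
move=> OO; elim: s s' e x y => [|s IH] [|s'] // e x y; rewrite ltnS => ss'.
have IHs e' x' y' := IH s' e' x' y' ss'.
case: e => [|[|[|[|[|e]]]]] //; first exact: OO.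
rewrite [X in X = _ -> _]/= [X in _ -> X = _]/=.
case: (e %% 4) => [|[|[|_]]].
- case Ef: (crun O s _ _) => [u|] //; rewrite (IHs _ _ _ Ef).
  by case Eg: (crun O s _ _) => [v|] //; rewrite (IHs _ _ _ Eg).
- case Ef: (crun O s _ _) => [u|] //; rewrite (IHs _ _ _ Ef).
  exact: IHs.
- case: (Cantor.of_nat x) => a [|m] /=; first exact: IHs.
  case Ef: (crun O s _ _) => [u|] //; rewrite (IHs _ _ _ Ef).
  exact: IHs.
- case Ef: (crun O s _ _) => [u|] //; rewrite (IHs _ _ _ Ef).
  by case: ifP => // _; exact: IHs.
Qed.

(* The finite partial oracle given by a string; if the flag is set, it is
   extended by 0. *)
Definition ask (o : bool * seq bool) (n : nat) : option nat :=
  if n < size o.2 then Some (nth false o.2 n : nat) else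
  if o.1 then Some 0 else None.

Lemma calc_ask X A {cA : code A} (o : A -> bool * seq bool) (n : A -> nat) :
  calc X o -> calc X n -> calc X (fun a => ask (o a) (n a)).
Proof. by move=> Ho Hn; rewrite /ask; calc_auto. Qed.
#[local] Hint Resolve calc_ask : calc.

(* A stack machine for [crun]: either <s, e, x> is to be evaluated, or a value
   is to be passed to the top frame <kind, s, u, v> of the stack. A failing
   computation empties the stack. *)
Notation machine :=
  (option (nat * nat * nat) * option nat * seq (nat * nat * nat * nat))%type.

Definition mret (y : nat) K : machine := (None, Some y, K).
Definition mfail : machine := (None, None, [::]).
Definition mgo s e x K : machine := (Some (s, e, x), None, K).

Definition mstart (o : bool * seq bool) (s e x : nat) K : machine :=
  if s isn't s'.+1 then mfail else
  match e with
  | 0 => mret 0 K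
  | 1 => mret x.+1 K
  | 2 => mret (Cantor.of_nat x).1 K
  | 3 => mret (Cantor.of_nat x).2 K
  | 4 => if ask o x is Some y then mret y K else mfail
  | e'.+4.+1 =>
      match e' %% 4 with
      | 0 => mgo s' (Cantor.of_nat (e' %/ 4)).1 x
               ((0, s', (Cantor.of_nat (e' %/ 4)).2, x) :: K)
      | 1 => mgo s' (Cantor.of_nat (e' %/ 4)).2 x
               ((2, s', (Cantor.of_nat (e' %/ 4)).1, 0) :: K)
      | 2 => if (Cantor.of_nat x).2 is m.+1 then
               mgo s' e (pair_code (Cantor.of_nat x).1 m)
                 ((3, s', (Cantor.of_nat (e' %/ 4)).2,
                   pair_code (Cantor.of_nat x).1 m) :: K)
             else mgo s' (Cantor.of_nat (e' %/ 4)).1 (Cantor.of_nat x).1 K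
      | _ => mgo s' (e' %/ 4) x ((4, s', e, x) :: K)
      end
  end.

Definition mresume (y k s u v : nat) K : machine :=
  match k with
  | 0 => mgo s u v ((1, 0, y, 0) :: K)
  | 1 => mret (pair_code u y) K
  | 2 => mgo s u y K
  | 3 => mgo s u (pair_code (Cantor.of_nat v).1
                    (pair_code (Cantor.of_nat v).2 y)) K
  | _ => if y == 0 then mret (Cantor.of_nat v).2 K
         else mgo s u (pair_code (Cantor.of_nat v).1 (Cantor.of_nat v).2.+1) K
  end.

Definition mstep (o : bool * seq bool) (st : machine) : machine :=
  if st.1.1 is Some t then mstart o t.1.1 t.1.2 t.2 st.2 else
  if st.1.2 is Some y then
    if st.2 is fr :: K then mresume y fr.1.1.1 fr.1.1.2 fr.1.2 fr.2 K else st
  else st.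

(** The stack [K] is arbitrary because a subcomputation runs on top of the frames of its callers; a
    value is returned to [K] itself, so that the runs of subcomputations can be chained. *)
Lemma mstep_crun o s e x K : exists n,
  iter n (mstep o) (mgo s e x K) =
  if crun (ask o) s e x is Some y then mret y K else mfail.
Proof.
have comp n m st st' st'' : iter n (mstep o) st = st' ->
    iter m (mstep o) st' = st'' -> exists k, iter k (mstep o) st = st''.
  by move=> <- <-; exists (m + n); rewrite iterD.
have fail m : iter m (mstep o) mfail = mfail by elim: m => //= m ->.
elim: s e x K => [|s IH] e x K; first by exists 1.
case: e => [|[|[|[|[|e]]]]]; try by exists 1; rewrite /= /mstep /mstart /=; case: ask.
rewrite [crun _ _ _ _]/=.
have go st st' : mstep o st = st' ->
  forall P, (exists k, iter k (mstep o) st' = P) ->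
  exists k, iter k (mstep o) st = P.
  by move=> <- P [k Hk]; exists k.+1; rewrite iterSr.
apply: (go _ _ erefl); rewrite [mstep o (mgo _ _ _ _)]/mstep /mstart /=.
case: (e %% 4) => [|[|[|_]]].
- have [n Hn] := IH (Cantor.of_nat (e %/ 4)).1 x
    ((0, s, (Cantor.of_nat (e %/ 4)).2, x) :: K).
  case Ef: (crun _ s _ _) Hn => [y|] Hn; last by exists n.
  have [m Hm] := IH (Cantor.of_nat (e %/ 4)).2 x ((1, 0, y, 0) :: K).
  have [k] := comp _ m.+1 _ _ _ Hn (iterSr _ _ _).
  rewrite Hm; case: (crun _ s _ _) => [z|] Hk; last by exists k.
  by apply: (comp _ 1 _ _ _ Hk).
- have [n Hn] := IH (Cantor.of_nat (e %/ 4)).2 x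
    ((2, s, (Cantor.of_nat (e %/ 4)).1, 0) :: K).
  case Ef: (crun _ s _ _) Hn => [y|] Hn; last by exists n.
  have [m Hm] := IH (Cantor.of_nat (e %/ 4)).1 y K.
  have [k] := comp _ m.+1 _ _ _ Hn (iterSr _ _ _).
  by rewrite Hm => Hk; exists k.
- case: (Cantor.of_nat x).2 => [|j]; first exact: IH.
  have [n Hn] := IH e.+4.+1 (pair_code (Cantor.of_nat x).1 j)
    ((3, s, (Cantor.of_nat (e %/ 4)).2, pair_code (Cantor.of_nat x).1 j) :: K).
  case Ef: (crun _ s _ _) Hn => [y|] Hn; last by exists n.
  have [m Hm] := IH (Cantor.of_nat (e %/ 4)).2
    (pair_code (Cantor.of_nat x).1 (pair_code j y)) K.
  have [k] := comp _ m.+1 _ _ _ Hn (iterSr _ _ _).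
  rewrite [mstep o (mret _ _)]/mstep /mresume /= of_pair_code Hm => Hk.
  by exists k.
- have [n Hn] := IH (e %/ 4) x ((4, s, e.+4.+1, x) :: K).
  case Ef: (crun _ s _ _) Hn => [y|] Hn; last by exists n.
  have [m Hm] := IH e.+4.+1
    (pair_code (Cantor.of_nat x).1 (Cantor.of_nat x).2.+1) K.
  have [k] := comp _ m.+1 _ _ _ Hn (iterSr _ _ _).
  rewrite [mstep o (mret _ _)]/mstep /mresume /=.
  case: eqP => y0 Hk; last by exists k; rewrite Hk.
  by apply: (comp _ 1 _ _ _ Hn); rewrite /= /mstep /mresume /= y0.
Qed.

Lemma calc_mstep X A {cA : code A} (o : A -> bool * seq bool) (st : A -> machine) :
  calc X o -> calc X st -> calc X (fun a => mstep (o a) (st a)).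
Proof.
by move=> Ho Hst; rewrite /mstep /mstart /mresume /mret /mfail /mgo; calc_auto.
Qed.
#[local] Hint Resolve calc_mstep : calc.

Lemma calc_iter X A B {cA : code A} {cB : code B} (f : A -> B -> B)
    (x : A -> B) (n : A -> nat) :
  calc X (fun p : A * B => f p.1 p.2) -> calc X x -> calc X n ->
  calc X (fun a => iter (n a) (f a) (x a)).
Proof.
move=> Hf Hx Hn.
apply: (@calc_ext _ _ _ _ _
  (fun a => nat_rect (fun=> B) (x a) (fun _ => f a) (n a))).
  by move=> a; elim: (n a) => //= m ->.
apply: calc_nat_rect => //.
by apply: (calc_comp (f := fun p => (p.1.1, p.2)) Hf); calc_auto.
Qed.
#[local] Hint Resolve calc_iter : calc.

Lemma calc_isSome X A B {cA : code A} {cB : code B} (o : A -> option B) :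
  calc X o -> calc X (fun a => isSome (o a)).
Proof. by move=> Ho; rewrite /isSome; calc_auto. Qed.

Lemma calc_nilp X A B {cA : code A} {cB : code B} (l : A -> seq B) :
  calc X l -> calc X (fun a => nilp (l a)).
Proof. by move=> Hl; rewrite /nilp; calc_auto. Qed.
#[local] Hint Resolve calc_isSome calc_nilp : calc.

(** Divergence within the depth bound also halts the machine, as it empties the stack. The search
    for a halting time therefore always succeeds, and the value is read off the final state. *)
Lemma calc_crun X A {cA : code A} (o : A -> bool * seq bool) (s e x : A -> nat) :
  calc X o -> calc X s -> calc X e -> calc X x ->
  calc X (fun a => crun (ask (o a)) (s a) (e a) (x a)).
Proof.
move=> Ho Hs He Hx.
pose st a n := iter n (mstep (o a)) (mgo (s a) (e a) (x a) [::]).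
pose halted (m : machine) := ~~ isSome m.1.1 && nilp m.2.
have stop a : exists n, halted (st a n).
  have [n Hn] := mstep_crun (o a) (s a) (e a) (x a) [::].
  by exists n; rewrite /st Hn; case: crun.
have Hst n : calc X n -> calc X (fun a => st a (n a)).
  by move=> Hn; rewrite /st /mgo; calc_auto.
have [N HN Nst] : exists2 N, calc X N & forall a, halted (st a (N a)).
  exists (fun a => ex_minn (stop a)); last by move=> a; case: ex_minnP.
  apply: (@calc_search _ _ _ (fun a n => halted (st a n))).
  - by rewrite /halted /st /mgo; calc_auto.
  - by move=> a; case: ex_minnP.
  - by move=> a n; case: ex_minnP => k _ kmin nk; apply/negP => /kmin; lia.
apply: (@calc_ext _ _ _ _ _ (fun a => (st a (N a)).1.2)); last first.
  by apply: calc_snd; apply: calc_fst; exact: Hst.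
move=> a.
(* A halted machine no longer moves, so the state does not depend on the halting time. *)
have fixed m k : halted m -> iter k (mstep (o a)) m = m.
  case: m => [[[//|] v] [|//]] _; elim: k => //= k ->.
  by rewrite /mstep /=; case: v.
have [n Hn] := mstep_crun (o a) (s a) (e a) (x a) [::].
have Hn' : halted (st a n) by rewrite /st Hn; case: crun.
have -> : st a (N a) = st a n.
  have [le|/ltnW le] := leqP (N a) n.
    by rewrite -[in RHS](subnK le) /st iterD [RHS]fixed //; exact: Nst.
  by rewrite -[in LHS](subnK le) /st iterD [LHS]fixed.
by rewrite /st Hn; case: crun.
Qed.

#[global] Hint Resolve calc_iter calc_isSome calc_nilp calc_crun : calc.

(** * Blocks of questions to the jump *)

(* One step of [CodeSeq.decode_rec v q r]; the first component accumulates the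
   output. *)
Definition decode_step (st : seq nat * nat * nat * nat) :
    seq nat * nat * nat * nat :=
  match st.1.2 with
  | 0 => st
  | q.+1 => match st.2 with
    | 0 => (rcons st.1.1.1 st.1.1.2, 0, q, q)
    | 1 => (st.1.1.1, st.1.1.2.+1, q, q)
    | r.+2 => (st.1.1.1, st.1.1.2, q, r)
    end
  end.

Lemma decode_stepP v q r s l : q <= s ->
  let out st := rcons st.1.1.1 st.1.1.2 in
  out (iter s decode_step (l, v, q, r)) = l ++ CodeSeq.decode_rec v q r.
Proof.
move=> qs out; elim: s q r v l qs => [|s IH] [|q] r v l // qs; rewrite ?iterSr.
- by rewrite cats1.
- by rewrite (_ : decode_step _ = (l, v, 0, r)) // IH.
- case: r => [|[|r]]; rewrite [decode_step _]/= [CodeSeq.decode_rec _ _ _]/= IH //.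
  by rewrite cat_rcons.
Qed.

Lemma calc_CodeSeq_decode X A {cA : code A} (f : A -> nat) :
  calc X f -> calc X (fun a => CodeSeq.decode (f a)).
Proof.
move=> Hf.
pose st a := iter (f a) decode_step ([::], 0, (f a).-1, (f a).-1).
apply: (@calc_ext _ _ _ _ _ (fun a => if f a == 0 then [::] else
  rcons (st a).1.1.1 (st a).1.1.2)).
  move=> a; rewrite /st; case: (f a) => // n.
  exact: (decode_stepP _ _ _ (leqnSn n)).
by rewrite /st /decode_step; calc_auto.
Qed.
#[local] Hint Resolve calc_CodeSeq_decode : calc.

Lemma calc_string_code X A {cA : code A} (f : A -> seq bool) :
  calc X f -> calc X (fun a => string_code (f a)).
Proof. by move=> Hf; rewrite /string_code; calc_auto. Qed.
#[local] Hint Resolve calc_string_code : calc.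

Lemma calc_take X A B {cA : code A} {cB : code B} (f : A -> nat) (l : A -> seq B) :
  calc X f -> calc X l -> calc X (fun a => take (f a) (l a)).
Proof.
move=> Hf Hl; apply: (@calc_ext _ _ _ _ _ (fun a =>
  (iter (f a) (fun p : seq B * seq B => if p.2 is x :: s then (rcons p.1 x, s)
    else p) ([::], l a)).1)).
  move=> a; rewrite -[RHS]cat0s; elim: (f a) (l a) [::] => [|n IH] [|x s] t //.
  - by rewrite take0 cats0.
  - by rewrite take0 cats0.
  - by rewrite iterSr IH.
  - by rewrite iterSr IH cat_rcons.
calc_auto.
Qed.
#[local] Hint Resolve calc_take : calc.

Fixpoint strings (n : nat) : seq (seq bool) :=
  if n is m.+1 then
    flatten [seq [:: rcons s false; rcons s true] | s <- strings m]
  else [:: [::]].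

Lemma calc_strings X A {cA : code A} (f : A -> nat) :
  calc X f -> calc X (fun a => strings (f a)).
Proof.
move=> Hf; apply: (@calc_ext _ _ _ _ _ (fun a => iter (f a) (fun l =>
    flatten [seq [:: rcons s false; rcons s true] | s <- l]) [:: [::]])).
  by move=> a; elim: (f a) => //= n ->.
calc_auto.
Qed.
#[local] Hint Resolve calc_strings : calc.

(* Along a string, the approximations are taken at the stage given by its
   length. *)
Definition jump_at (sigma : seq bool) (q : nat) : bool :=
  isSome (crun (ask (false, sigma)) (size sigma) q q).

Definition tt_at (sigma : seq bool) (t : nat) : bool :=
  odd ((Cantor.of_nat t).2 %/
    2 ^ string_code (map (jump_at sigma) (CodeSeq.decode (Cantor.of_nat t).1))).

(* Question b of block j in the column that diagonalises against the alleged
   truth-table reduction i; there are j + 1 questions in block j. *)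
Definition question i j b := pair_code i (pair_code j b).

(** The empty string extended by 0 is the empty oracle. As [i] is an arbitrary program, a table may
    never appear. *)
Definition table_at (i j b s : nat) : option nat :=
  crun (ask (true, [::])) s i (question i j b).

(** While one of the tables is still missing, no vector agrees; afterwards exactly one vector of
    length [j.+1] does. *)
Definition agree (i j : nat) (w sigma : seq bool) : bool :=
  all (fun b => if table_at i j b (size sigma) is Some t
                then ~~ (tt_at sigma t (+) nth false w b) else false)
    (iota 0 j.+1).

(* The prediction made at stage s: by the pigeonhole principle, one of the
   vectors is given by at most the 2^-(j+1)-th part of the strings. *)
Definition rare (i j s : nat) : seq bool :=
  nth [::] [seq w <- strings j.+1 |
    size [seq sigma <- strings s | agree i j w sigma] * 2 ^ j.+1 <= 2 ^ s] 0.

(* Meant for strings of length s: the vector predicted at stage t was the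
   vector of answers along sigma at some stage r with t <= r <= s. *)
Definition hit (i j t s : nat) (sigma : seq bool) : bool :=
  has (fun r => agree i j (rare i j t) (take r sigma)) (iota t (s.+1 - t)).

Definition weight (i j t s : nat) : nat :=
  size [seq sigma <- strings s | hit i j t s sigma].

(* The stage at which the prediction that is current at stage s was made. *)
Fixpoint start (i j s : nat) : nat :=
  if s is s'.+1 then
    if 2 ^ s < weight i j (start i j s') s * 2 ^ j then s else start i j s'
  else 0.

Lemma calc_jump_at X A {cA : code A} (f : A -> seq bool) (g : A -> nat) :
  calc X f -> calc X g -> calc X (fun a => jump_at (f a) (g a)).
Proof. by move=> Hf Hg; rewrite /jump_at; calc_auto. Qed.

#[local] Hint Resolve calc_jump_at : calc.

Lemma calc_tt_at X A {cA : code A} (f : A -> seq bool) (g : A -> nat) :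
  calc X f -> calc X g -> calc X (fun a => tt_at (f a) (g a)).
Proof. by move=> Hf Hg; rewrite /tt_at; calc_auto. Qed.

Lemma calc_table_at X A {cA : code A} (i j b s : A -> nat) :
  calc X i -> calc X j -> calc X b -> calc X s ->
  calc X (fun a => table_at (i a) (j a) (b a) (s a)).
Proof. by move=> Hi Hj Hb Hs; rewrite /table_at /question; calc_auto. Qed.
#[local] Hint Resolve calc_tt_at calc_table_at : calc.

Lemma calc_addb X A {cA : code A} (b c : A -> bool) :
  calc X b -> calc X c -> calc X (fun a => b a (+) c a).
Proof.
move=> Hb Hc; apply: (@calc_ext _ _ _ _ _ (fun a => if b a then ~~ c a else c a)).
  by move=> a; case: (b a).
calc_auto.
Qed.
#[local] Hint Resolve calc_addb : calc.

Lemma calc_agree X A {cA : code A} (i j : A -> nat) (w sigma : A -> seq bool) :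
  calc X i -> calc X j -> calc X w -> calc X sigma ->
  calc X (fun a => agree (i a) (j a) (w a) (sigma a)).
Proof. by move=> Hi Hj Hw Hs; rewrite /agree; calc_auto. Qed.
#[local] Hint Resolve calc_agree : calc.

Lemma calc_rare X A {cA : code A} (i j s : A -> nat) :
  calc X i -> calc X j -> calc X s -> calc X (fun a => rare (i a) (j a) (s a)).
Proof. by move=> Hi Hj Hs; rewrite /rare; calc_auto. Qed.
#[local] Hint Resolve calc_rare : calc.

Lemma calc_hit X A {cA : code A} (i j t s : A -> nat) (sigma : A -> seq bool) :
  calc X i -> calc X j -> calc X t -> calc X s -> calc X sigma ->
  calc X (fun a => hit (i a) (j a) (t a) (s a) (sigma a)).
Proof. by move=> Hi Hj Ht Hs Hsigma; rewrite /hit; calc_auto. Qed.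
#[local] Hint Resolve calc_hit : calc.

Lemma calc_weight X A {cA : code A} (i j t s : A -> nat) :
  calc X i -> calc X j -> calc X t -> calc X s ->
  calc X (fun a => weight (i a) (j a) (t a) (s a)).
Proof. by move=> Hi Hj Ht Hs; rewrite /weight; calc_auto. Qed.
#[local] Hint Resolve calc_weight : calc.

Lemma calc_start X A {cA : code A} (i j s : A -> nat) :
  calc X i -> calc X j -> calc X s -> calc X (fun a => start (i a) (j a) (s a)).
Proof.
move=> Hi Hj Hs; apply: (@calc_ext _ _ _ _ _ (fun a =>
  nat_rect (fun=> nat) 0 (fun s' t =>
    if 2 ^ s'.+1 < weight (i a) (j a) t s'.+1 * 2 ^ j a then s'.+1 else t) (s a))).
  by move=> a; elim: (s a) => //= n ->.
calc_auto.
Qed.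
#[global] Hint Resolve calc_string_code calc_strings calc_agree calc_rare
  calc_hit calc_start calc_take : calc.

(** * Convergence of the predictions *)

Lemma ask_extend b sigma m n z :
  ask (false, take m sigma) n = Some z -> ask (b, sigma) n = Some z.
Proof.
rewrite /ask /= size_take_min; case: ltnP => //.
rewrite leq_min => /andP[nm ns] [<-].
by rewrite ns nth_take.
Qed.

(** A longer string supplies more of the oracle and more time, so the approximation to the jump only
    gains elements along it. *)
Lemma jump_at_take m sigma q : jump_at (take m sigma) q -> jump_at sigma q.
Proof.
rewrite /jump_at; case E: crun => [y|] // _.
rewrite (crun_mono _ _ E) //; last by rewrite size_take_min geq_minr.
exact: ask_extend.
Qed.

Lemma table_at_mono i j b s s' t :
  s <= s' -> table_at i j b s = Some t -> table_at i j b s' = Some t.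
Proof. by move=> ss'; exact: crun_mono. Qed.

(** * Counting strings *)

Lemma sum_stringsS n (F : seq bool -> nat) :
  \sum_(s <- strings n.+1) F s =
  \sum_(s <- strings n) (F (rcons s false) + F (rcons s true)).
Proof.
rewrite /= big_flatten big_map; apply: eq_bigr => s _.
by rewrite !big_cons big_nil /= addn0.
Qed.

Lemma mem_strings n s : (s \in strings n) = (size s == n).
Proof.
elim: n s => [|n IH] s; first by rewrite inE; case: s.
apply/flattenP/idP => [[_ /mapP[u un ->]]|].
  by move: un; rewrite IH !inE => /eqP <- /orP[] /eqP ->; rewrite size_rcons.
case/lastP: s => // s b; rewrite size_rcons eqSS -IH => sn.
by eexists; [apply: map_f sn|rewrite !inE !eqseq_rcons !eqxx; case: b].
Qed.

Lemma strings_uniq n : uniq (strings n).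
Proof.
have E m : strings m.+1 = [seq rcons s b | s <- strings m, b <- [:: false; true]].
  by [].
elim: n => // n IH; rewrite E; apply: allpairs_uniq => // -[s b] [t c] _ _ /=.
by move=> /rcons_inj[-> ->].
Qed.

Lemma size_strings n : size (strings n) = 2 ^ n.
Proof.
rewrite -sum1_size; elim: n => [|n IH]; first by rewrite big_seq1.
by rewrite sum_stringsS big_split /= IH expnS; lia.
Qed.

(** Each string of length [m] has [2 ^ k] extensions of length [k + m]. *)
Lemma sum_strings_take m k (F : seq bool -> nat) :
  \sum_(s <- strings (k + m)) F (take m s) = 2 ^ k * \sum_(s <- strings m) F s.
Proof.
elim: k => [|k IH].
  rewrite mul1n; apply: eq_big_seq => s; rewrite mem_strings => /eqP sm.
  by rewrite take_oversize ?sm.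
rewrite addSn sum_stringsS expnS -mulnA -IH big_distrr /=.
apply: eq_big_seq => s; rewrite mem_strings => /eqP sk.
by rewrite -!cats1 !takel_cat ?sk ?leq_addl //; lia.
Qed.

Lemma size_filterE (P : pred (seq bool)) (l : seq (seq bool)) :
  size (seq.filter P l) = \sum_(s <- l) P s.
Proof.
by rewrite size_filter -sum1_count big_mkcond; apply: eq_bigr => s _; case: P.
Qed.

Lemma agree_inj i j w w' sigma : size w = j.+1 -> size w' = j.+1 ->
  agree i j w sigma -> agree i j w' sigma -> w = w'.
Proof.
move=> sw sw' /allP H /allP H'.
apply: (@eq_from_nth _ false); rewrite ?sw ?sw' // => b bj.
have bi : b \in iota 0 j.+1 by rewrite mem_iota.
move: (H b bi) (H' b bi); case: table_at => // t.
by case: tt_at; case: nth; case: nth.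
Qed.

(** A string agrees with at most one vector, so the counts for the [2 ^ j.+1] vectors add up to at
    most [2 ^ s] and cannot all exceed the average. *)
Lemma exists_rare i j s : exists2 w, w \in strings j.+1 &
  size [seq sigma <- strings s | agree i j w sigma] * 2 ^ j.+1 <= 2 ^ s.
Proof.
apply/hasP; apply: contraT => /hasPn H.
have : \sum_(w <- strings j.+1)
    size [seq sigma <- strings s | agree i j w sigma] <= 2 ^ s.
  under eq_bigr do rewrite size_filterE.
  rewrite exchange_big -size_strings -sum1_size; apply: leq_sum => sigma _.
  rewrite -size_filterE; set l := seq.filter _ _.
  have ul : uniq l by rewrite filter_uniq // strings_uniq.
  case El: l ul => [|u [|v l']] //=.
  have [ul vl] : u \in l /\ v \in l by rewrite El !inE !eqxx orbT.
  move: ul vl; rewrite !mem_filter !mem_strings.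
  move=> /andP[au /eqP su] /andP[av /eqP sv].
  by rewrite (agree_inj su sv au av) inE eqxx.
set f := fun w => size [seq sigma <- strings s | agree i j w sigma].
move=> Hf.
have : 2 ^ j.+1 * (2 ^ s).+1 <= (\sum_(w <- strings j.+1) f w) * 2 ^ j.+1.
  rewrite -{1}(size_strings j.+1) -sum1_size !big_distrl !big_seq.
  apply: leq_sum => w /H; rewrite -ltnNge => lt.
  by change (1 * (2 ^ s).+1 <= f w * 2 ^ j.+1); rewrite mul1n.
rewrite mulnC leq_pmul2r ?expn_gt0 // => /leq_trans /(_ Hf).
by rewrite ltnn.
Qed.

Lemma rareP i j s : size (rare i j s) = j.+1 /\
  size [seq sigma <- strings s | agree i j (rare i j s) sigma] * 2 ^ j.+1 <= 2 ^ s.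
Proof.
have [w wj Hw] := exists_rare i j s.
have : rare i j s \in [seq w <- strings j.+1 |
    size [seq sigma <- strings s | agree i j w sigma] * 2 ^ j.+1 <= 2 ^ s].
  apply: mem_nth; rewrite -has_predT; apply/hasP; exists w => //.
  by rewrite mem_filter Hw.
by rewrite mem_filter mem_strings => /andP[-> /eqP ->].
Qed.

Lemma start_le i j s : start i j s <= s.
Proof. by elim: s => //= s IH; case: ifP => // _; exact: leqW. Qed.

(** When a prediction is made, the only stage that counts for [hit] is the present one, where the
    vector is rare; later on, exceeding the bound triggers a new prediction. *)
Lemma weight_start i j s : weight i j (start i j s) s * 2 ^ j <= 2 ^ s.
Proof.
have same t : weight i j t t * 2 ^ j <= 2 ^ t.
  have [_] := rareP i j t; apply: leq_trans.
  rewrite expnS mulnCA; apply: leq_trans (leq_pmull _ _) => //.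
  rewrite leq_mul2r; apply/orP; right; rewrite /weight.
  rewrite (_ : [seq _ <- _ | _] =
    [seq sigma <- strings t | agree i j (rare i j t) sigma]) //.
  apply: eq_in_filter => sigma; rewrite mem_strings => /eqP <-.
  by rewrite /hit subSnn /= orbF take_size.
case: s => [|s]; first exact: same.
by rewrite /start -/start; case: ifP => [_|/negbT]; [exact: same|rewrite -leqNgt].
Qed.

(* Every change of the answers along a string increases this number. *)
Definition progress (i j : nat) (sigma : seq bool) : nat :=
  \sum_(b <- iota 0 j.+1)
    if table_at i j b (size sigma) is Some t
    then (count (jump_at sigma) (CodeSeq.decode (Cantor.of_nat t).1)).+1 else 0.

(** A table that ever appears is the same at all later stages and contributes at most one more than
    the number of its queries; the others contribute nothing. *)
Lemma progress_bounded i j : exists K, forall sigma, progress i j sigma <= K.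
Proof.
rewrite /progress; elim: (iota 0 j.+1) => [|b l [K HK]].
  by exists 0 => sigma; rewrite big_nil.
have [[s [t st]]|N] := pselect (exists s t, table_at i j b s = Some t).
  exists ((size (CodeSeq.decode (Cantor.of_nat t).1)).+1 + K) => sigma.
  rewrite big_cons; apply: leq_add; last exact: HK.
  case E: table_at => [t'|] //.
  suff -> : t' = t by rewrite ltnS count_size.
  apply: Some_inj; have [le|/ltnW le] := leqP s (size sigma).
    by rewrite -(table_at_mono le st) E.
  by rewrite -(table_at_mono le E) st.
exists K => sigma; rewrite big_cons; case E: table_at => [t|]; last exact: HK.
by case: N; exists (size sigma), t.
Qed.

Lemma progress_take i j m sigma : progress i j (take m sigma) <= progress i j sigma.
Proof.
apply: leq_sum => b _; case E: table_at => [t|] //.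
rewrite (table_at_mono _ E) ?ltnS; last by rewrite size_take_min geq_minr.
by apply: sub_count => q; exact: jump_at_take.
Qed.

(** Some question was without table or with another answer at the shorter string. A new table makes
    its summand positive; a changed answer requires a query that has newly entered the jump. *)
Lemma progress_lt i j w m sigma : agree i j w sigma ->
  ~~ agree i j w (take m sigma) -> progress i j (take m sigma) < progress i j sigma.
Proof.
move=> /allP ag /allPn[b bj nag].
have szm : size (take m sigma) <= size sigma by rewrite size_take_min geq_minr.
rewrite /progress !(big_rem b bj) /= -addSn; apply: leq_add; last first.
  apply: leq_sum => c _; case E: table_at => [t|] //.
  rewrite (table_at_mono szm E) ltnS.
  by apply: sub_count => q; exact: jump_at_take.
move: (ag b bj) nag; case E: (table_at _ _ _ (size (take _ _))) => [t|]; last first.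
  by case: table_at.
rewrite (table_at_mono szm E) !ltnS => ag1 nag1.
rewrite ltn_neqAle sub_count; last by move=> q; exact: jump_at_take.
rewrite andbT; apply/eqP => Ecount; move: nag1; rewrite negbK.
(* Since queries only enter the jump, equal counts force the same reply to every query, hence the
   same verdict of the truth table. *)
suff -> : tt_at (take m sigma) t = tt_at sigma t by rewrite (negbTE ag1).
rewrite /tt_at; congr (odd (_ %/ 2 ^ string_code _)).
elim: (CodeSeq.decode _) Ecount => //= q l IH.
have le : count (jump_at (take m sigma)) l <= count (jump_at sigma) l.
  by apply: sub_count => q'; exact: jump_at_take.
have := @jump_at_take m sigma q.
case: (jump_at _ q); case: (jump_at _ q) => //= H; last 2 first.
- lia.
- by move=> /IH ->.
- by case=> /IH ->.
- by have := H isT.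
Qed.

(** With denominators cleared: a restart raises the mean of [progress] over the strings of a stage
    by at least 2^-(j+1). More than the 2^-j-th part has met the prediction, at most the 2^-(j+1)-th
    part did so when it was made, and each of the others has gained progress. *)
Lemma restart_progress i j s : start i j s.+1 = s.+1 ->
  2 ^ (s.+1 - start i j s) *
    (\sum_(sigma <- strings (start i j s)) progress i j sigma) * 2 ^ j.+1
    + 2 ^ s.+1
  <= (\sum_(sigma <- strings s.+1) progress i j sigma) * 2 ^ j.+1.
Proof.
have ts := start_le i j s; rewrite [start i j s.+1]/= -/start.
set t := start i j s in ts *; case: ifP => [w _|_ E]; last by lia.
have [_ Hr] := rareP i j t; set r := rare i j t in Hr.
set N := \sum_(sigma <- strings s.+1)
  (hit i j t s.+1 sigma && ~~ agree i j r (take t sigma)).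
have E : s.+1 = s.+1 - t + t by lia.
have H1 : weight i j t s.+1 <= N +
    2 ^ (s.+1 - t) * size [seq sigma <- strings t | agree i j r sigma].
  rewrite /weight size_filterE size_filterE.
  rewrite -(sum_strings_take t _ (fun sigma => agree i j r sigma)) -E /N.
  rewrite -big_split /=.
  by apply: leq_sum => sigma _; case: hit => //=; case: agree.
have H2 : 2 ^ s.+1 <= N * 2 ^ j.+1.
  have : weight i j t s.+1 * 2 ^ j.+1 <= (N + 2 ^ (s.+1 - t) *
      size [seq sigma <- strings t | agree i j r sigma]) * 2 ^ j.+1.
    by rewrite leq_mul2r H1 orbT.
  have : 2 ^ (s.+1 - t) *
      (size [seq sigma <- strings t | agree i j r sigma] * 2 ^ j.+1)
     <= 2 ^ (s.+1 - t) * 2 ^ t by rewrite leq_mul2l Hr orbT.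
  rewrite -expnD -E mulnDl -mulnA.
  have -> : weight i j t s.+1 * 2 ^ j.+1 = 2 * (weight i j t s.+1 * 2 ^ j).
    by rewrite expnS; lia.
  lia.
apply: leq_trans (_ : (2 ^ (s.+1 - t) *
  (\sum_(sigma <- strings t) progress i j sigma) + N) * 2 ^ j.+1 <= _).
  by rewrite mulnDl leq_add2l.
rewrite leq_mul2r; apply/orP; right.
rewrite -(sum_strings_take t _ (progress i j)) -E /N -big_split /=.
(* A string counted in [N] agrees at some length [m >= t] but not at [t], so its progress rises
   between [t] and [m]. *)
apply: leq_sum => sigma _; case: (boolP (hit _ _ _ _ _ && _)); last first.
  by rewrite addn0 => _; exact: progress_take.
rewrite addn1 => /andP[/hasP[m]]; rewrite mem_iota => /andP[tm _] am nag.
apply: leq_trans (progress_take i j m sigma).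
rewrite -(take_takel sigma tm); apply: progress_lt am _.
by rewrite take_takel.
Qed.

(** Infinitely many restarts would raise the mean of [progress] beyond the uniform bound [K]. *)
Lemma start_cvg i j : exists s0, forall s, s0 <= s -> start i j s = start i j s0.
Proof.
apply: contrapT => N.
have {}N s0 : exists s, s0 <= s /\ start i j s <> start i j s0.
  apply: contrapT => N'; apply: N; exists s0 => s ss.
  by apply: contrapT => E; apply: N'; exists s.
pose P s := \sum_(sigma <- strings s) progress i j sigma.
have [K HK] := progress_bounded i j.
(* After [n] restarts the mean is at least n 2^-(j+1). The next restart is found as the least later
   stage at which [start] differs. *)
have big n : exists2 t, start i j t = t & n * 2 ^ t <= P t * 2 ^ j.+1.
  elim: n => [|n [t tt Pt]]; first by exists 0.
  have ex : exists s, (t <= s) && (start i j s != t).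
    by have [s [ts sE]] := N t; exists s; rewrite ts; apply/eqP; rewrite -[in RHS]tt.
  have [[|s] /andP[ts /eqP sE] smin] := ex_minnP ex.
    by move: ts sE tt; rewrite leqn0 => /eqP ->.
  have {}smin : start i j s = t.
    apply/eqP; apply: contraT => st.
    have [ts'|ts'] := leqP t s.
      by have := smin s; rewrite ts' st /= => /(_ isT); rewrite ltnn.
    by case: sE; have -> : s.+1 = t by lia.
  have sE' : start i j s.+1 = s.+1.
    by move: sE; rewrite /= smin; case: ifP.
  exists s.+1 => //; have := restart_progress sE'; rewrite smin -/(P t) -/(P s.+1).
  have ts' : t <= s.+1 by [].
  apply: leq_trans; rewrite mulSn addnC leq_add2r -mulnA.
  by rewrite -{1}(subnK ts') expnD mulnCA leq_mul2l Pt orbT.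
have [t _] := big (K * 2 ^ j.+1).+1.
rewrite leqNgt => /negP; apply.
apply: (@leq_ltn_trans (K * 2 ^ t * 2 ^ j.+1)).
  rewrite leq_mul2r; apply/orP; right.
  rewrite -size_strings -sum1_size big_distrr /=.
  by apply: leq_sum => sigma _; rewrite muln1.
by rewrite mulSn mulnAC -[ltnLHS]add0n ltn_add2r expn_gt0.
Qed.

(** * A superhigh set answers all questions *)

(* The s-m-n theorem for Sigma_1 predicates and the diagonal halting problem. *)
Lemma jump_reduction X (P : nat -> nat -> bool) :
  calc X (fun p : nat * nat => P p.1 p.2) ->
  exists2 h : nat -> nat, forall Y, calc Y h &
    forall x, jump X (h x) <-> exists n, P x n.
Proof.
move=> /ce_of_calc[e He].
pose const (x : nat) := iter x (PComp PSucc) PZero.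
have eval_const x y : eval X (const x) y x.
  by elim: x => [|x IH]; [exists 1|apply: eval_comp IH _; exists 1].
(* This program ignores its input, so that running it on its own index amounts to running [e] on
   [x]. *)
exists (fun x => encode (PComp (decode e) (const x))) => [Y|x].
  (* The constants come from [encode]: 6 belongs to [PComp], while 0 and 1 are the codes of [PZero]
     and [PSucc]. *)
  apply: (@calc_ext _ _ _ _ _ (fun x => 6 + 4 * pair_code e
    (nat_rect (fun=> nat) 0 (fun _ r => 6 + 4 * pair_code 1 r) x))).
    have E x : nat_rect (fun=> nat) 0 (fun _ r => 6 + 4 * pair_code 1 r) x =
               encode (const x) by elim: x => // x IH; rewrite [LHS]/= IH.
    by move=> x; rewrite E /= decodeK.
  calc_auto.
rewrite -He; split=> [/asboolP/evalP[y /eval_compE[z Hz Hy]]|].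
  rewrite /halts -(decodeK e); apply/evalP; exists y.
  by rewrite (eval_inj (eval_const x _) Hz).
rewrite -{1}(decodeK e) => /evalP[y Hy]; apply/asboolP/evalP; exists y.
exact: eval_comp (eval_const x _) Hy.
Qed.

Definition answer_at (n s : nat) : bool :=
  let i := (Cantor.of_nat n).1 in
  let j := (Cantor.of_nat (Cantor.of_nat n).2).1 in
  nth false (rare i j (start i j s)) (Cantor.of_nat (Cantor.of_nat n).2).2.

(* The Delta_2 set that diagonalises. *)
Definition answer (n : nat) : Prop :=
  exists t, forall s, t <= s -> answer_at n s.

Lemma answer_question i j b s0 :
  (forall s, s0 <= s -> start i j s = start i j s0) ->
  answer (question i j b) <-> nth false (rare i j (start i j s0)) b.
Proof.
move=> cvg; rewrite /answer /answer_at /question of_pair_code /= of_pair_code /=.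
split=> [[t Ht]|H].
  by have := Ht (maxn t s0); rewrite cvg ?leq_maxr // leq_maxl => /(_ isT).
by exists s0 => s /cvg ->.
Qed.

(** That the answer is [false] at some stage from [t] on is a Sigma_1 event, decided by the first
    jump through [h]. The existence of a [t] without such a stage is then Sigma_1 in the first
    jump. *)
Lemma answer_reduction : exists2 g : nat -> nat, forall Y, calc Y g &
  forall n, jump (jump oracle0) (g n) <-> answer n.
Proof.
have C X A (cA : code A) (f g : A -> nat) : calc X f -> calc X g ->
    calc X (fun a => answer_at (f a) (g a)).
  by move=> Hf Hg; rewrite /answer_at; calc_auto.
have [|h Hh hP] := @jump_reduction oracle0 (fun y s =>
    ((Cantor.of_nat y).2 <= s) && ~~ answer_at (Cantor.of_nat y).1 s).
  by apply: calc_andb; [|apply: calc_negb; apply: C]; calc_auto.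
have [|g Hg gP] := @jump_reduction (jump oracle0) (fun n t =>
    ~~ jump oracle0 (h (pair_code n t))).
  apply: calc_negb; apply: calc_oracle; apply: calc_comp; first exact: Hh.
  calc_auto.
exists g => // n; rewrite gP; split=> -[t Ht]; exists t.
  move=> s ts; apply: contraNT Ht => ns; apply/hP; exists s.
  by rewrite of_pair_code /= ts.
by apply/negP => /hP[s]; rewrite of_pair_code /= => /andP[/Ht ->].
Qed.

Lemma crun_oracle0 s e x : crun (ask (true, [::])) s e x = run oracle0 s (decode e) x.
Proof. by rewrite -crun_decode; congr (crun _ s e x). Qed.

(** [i] is a program for the truth-table reduction of the second jump composed with the many-one
    reduction of [answer] to it. *)
Lemma superhigh_index Z : superhigh Z -> exists i, forall n,
  exists s t, crun (ask (true, [::])) s i n = Some t /\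
    (tt_sat (jump Z) t <-> answer n).
Proof.
case=> f Hf fP; have [g Hg gP] := answer_reduction.
have [c Hc] : calc oracle0 (fun n : nat => f (g n)).
  by apply: calc_comp (Hg _); exact: Hf.
exists (encode c) => n; have [s Hs] := Hc n; exists s, (f (g n)).
by rewrite crun_oracle0 encodeK Hs -fP gP.
Qed.

(** The use principle: a converging computation asks only finitely many queries, so some initial
    segment of the oracle suffices. *)
Lemma crun_use (X : nat -> bool) s e x y :
  crun (fun n => Some (X n : nat)) s e x = Some y ->
  exists k, crun (ask (false, mkseq X k)) s e x = Some y.
Proof.
have ext k k' : k <= k' -> forall n z, ask (false, mkseq X k) n = Some z ->
    ask (false, mkseq X k') n = Some z.
  move=> kk n z; rewrite /ask /= !size_mkseq; case: ltnP => // nk.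
  by rewrite (leq_trans nk kk) !nth_mkseq // (leq_trans nk kk).
have extl k k' := @crun_mono _ _ _ _ _ _ _ (ext _ _ (leq_maxl k k')) (leqnn _).
have extr k k' := @crun_mono _ _ _ _ _ _ _ (ext _ _ (leq_maxr k k')) (leqnn _).
elim: s e x y => [|s IH] // e x y.
case: e => [|[|[|[|[|e]]]]]; try by move=> E; exists 0.
  move=> E; exists x.+1; change (ask (false, mkseq X x.+1) x = Some y).
  by rewrite /ask (_ : (false, mkseq X x.+1).2 = mkseq X x.+1) // size_mkseq
    ltnSn nth_mkseq.
rewrite [X in X = _ -> _]/= [X in exists k, X k]/=.
case: (e %% 4) => [|[|[|_]]].
- case Ef: (crun _ s _ _) => [u|] //; case Eg: (crun _ s _ _) => [v|] //.
  have [k Hk] := IH _ _ _ Ef; have [l Hl] := IH _ _ _ Eg => E.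
  by exists (maxn k l); rewrite (extl _ _ _ _ _ _ Hk) (extr _ _ _ _ _ _ Hl).
- case Ef: (crun _ s _ _) => [u|] // Eg.
  have [k Hk] := IH _ _ _ Ef; have [l Hl] := IH _ _ _ Eg.
  by exists (maxn k l); rewrite (extl _ _ _ _ _ _ Hk) (extr _ _ _ _ _ _ Hl).
- case: (Cantor.of_nat x) => a [|m] /=; first exact: IH.
  case Ef: (crun _ s _ _) => [u|] // Eg.
  have [k Hk] := IH _ _ _ Ef; have [l Hl] := IH _ _ _ Eg.
  by exists (maxn k l); rewrite (extl _ _ _ _ _ _ Hk) (extr _ _ _ _ _ _ Hl).
- case Ef: (crun _ s _ _) => [u|] //; have [k Hk] := IH _ _ _ Ef.
  case u0: (u == 0) => Eg; first by exists k; rewrite Hk u0.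
  have [l Hl] := IH _ _ _ Eg.
  by exists (maxn k l); rewrite (extl _ _ _ _ _ _ Hk) u0 (extr _ _ _ _ _ _ Hl).
Qed.

Lemma take_mkseq T (f : nat -> T) m n : m <= n -> take m (mkseq f n) = mkseq f m.
Proof. by move=> mn; rewrite /mkseq -map_take take_iota (minn_idPl mn). Qed.

Lemma jump_at_cvg Z q : exists s0, forall s, s0 <= s ->
  jump_at (mkseq Z s) q = jump Z q.
Proof.
have [[s0]|N] := pselect (halts Z q q).
  case E: run => [y|] // _; move: E; rewrite -crun_decode => /crun_use[k Hk].
  exists (maxn s0 k) => s; rewrite geq_max => /andP[s0s ks].
  have -> : jump Z q by apply/asboolP; exists s0; rewrite -crun_decode;
    rewrite (crun_mono _ (leqnn _) Hk) // => n z; rewrite /ask /= size_mkseq;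
    case: ltnP => // nk <-; rewrite nth_mkseq.
  rewrite /jump_at (crun_mono _ _ Hk) //; last by rewrite size_mkseq.
  by rewrite -(take_mkseq Z ks) => n z; exact: ask_extend.
exists 0 => s _; apply/idP/asboolP => // H; case: N; move: H; rewrite /jump_at.
case E: crun => [y|] // _; exists s; rewrite -crun_decode.
rewrite size_mkseq in E; rewrite (crun_mono _ (leqnn _) E) // => n z.
by rewrite /ask /= size_mkseq; case: ltnP => // nk <-; rewrite nth_mkseq.
Qed.

Lemma eventually_all (T : eqType) (l : seq T) (P : T -> nat -> Prop) :
  (forall x, x \in l -> exists s0, forall s, s0 <= s -> P x s) ->
  exists s0, forall s, s0 <= s -> forall x, x \in l -> P x s.
Proof.
elim: l => [|x l IH] H; first by exists 0.
have [|s0 H0] := IH; first by move=> y yl; apply: H; rewrite inE yl orbT.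
have [s1 H1] := H x (mem_head _ _); exists (maxn s0 s1) => s.
rewrite geq_max => /andP[s0s s1s] y; rewrite inE => /predU1P[->|]; first exact: H1.
exact: H0.
Qed.

Lemma tt_at_cvg Z t : exists s0, forall s, s0 <= s ->
  tt_at (mkseq Z s) t <-> tt_sat (jump Z) t.
Proof.
have [|s0 H] := @eventually_all _ (CodeSeq.decode (Cantor.of_nat t).1)
    (fun q s => jump_at (mkseq Z s) q = jump Z q).
  by move=> q _; exact: jump_at_cvg.
exists s0 => s /H{}H; rewrite /tt_at /tt_sat.
have -> : map (jump_at (mkseq Z s)) (CodeSeq.decode (Cantor.of_nat t).1) =
  map (jump Z) (CodeSeq.decode (Cantor.of_nat t).1) by exact/eq_in_map.
by case: (Cantor.of_nat t).
Qed.

(** At late stages the prediction is final, the finitely many tables are known, and their values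
    along [Z] have reached their limits. These are the true answers, which are the predicted ones by
    the choice of [answer]; so [Z] agrees at the current stage itself. *)
Lemma superhigh_hit Z : superhigh Z -> exists i, forall j,
  exists s0, forall s, s0 <= s -> hit i j (start i j s) s (mkseq Z s).
Proof.
move=> /superhigh_index[i Hi]; exists i => j.
have [s1 start1] := start_cvg i j.
have [|s0 H] := @eventually_all _ (iota 0 j.+1) (fun b s =>
    if table_at i j b s is Some t
    then ~~ (tt_at (mkseq Z s) t (+) nth false (rare i j (start i j s1)) b)
    else false).
  move=> b _; have [s2 [t [run2 tP]]] := Hi (question i j b).
  have [s3 Hs3] := tt_at_cvg Z t; exists (maxn s2 s3) => s.
  rewrite geq_max => /andP[s2s s3s]; rewrite (table_at_mono s2s run2).
  have E : tt_at (mkseq Z s) t <-> nth false (rare i j (start i j s1)) b.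
    by rewrite Hs3 // tP; exact: answer_question.
  rewrite addbC -addbN addbC; apply/idP.
  by case: tt_at E; case: nth => //= -[H1 H2]; [have := H1 isT|have := H2 isT].
exists (maxn s0 s1) => s; rewrite geq_max => /andP[s0s s1s]; rewrite start1 //.
apply/hasP; exists s.
  rewrite mem_iota -(start1 s s1s) subnKC ?start_le ?leqnn //.
  exact: leq_trans (start_le _ _ _) (leqnSn _).
rewrite take_mkseq //; apply/allP => b bj; rewrite size_mkseq.
by have := H s s0s b bj; case: table_at.
Qed.

(** * The promptly simple set *)

Lemma leq_pair_code x y x' y' :
  x <= x' -> y <= y' -> pair_code x y <= pair_code x' y'.
Proof.
move=> /ssrnat.leP xx /ssrnat.leP yy.
have := Cantor.to_nat_spec x y; have := Cantor.to_nat_spec x' y'.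
by move=> H1 H2; apply/ssrnat.leP; nia.
Qed.

Definition W_stage (e s x : nat) : bool :=
  (x < s) && isSome (crun (ask (true, [::])) s e x).

Lemma W_stageP e s x : W_at e s x <-> W_stage e s x.
Proof. by rewrite /W_at /W_stage /= crun_oracle0; case: run. Qed.

Notation stage w := (Cantor.of_nat w).1.
Notation elt w := (Cantor.of_nat w).2.

(* At its stage, w would put its element into the promptly simple set on behalf
   of W_j. *)
Definition eligible (j w : nat) : bool :=
  [&& W_stage j (stage w) (elt w), ~~ W_stage j (stage w).-1 (elt w),
      j.*2 <= elt w &
      all (fun i => start i j (elt w) == start i j (stage w)) (iota 0 j.+1)].

(** Only the least eligible [w] acts, so each [j] contributes at most one number. *)
Definition acts (j w : nat) : bool :=
  eligible j w && ~~ has (eligible j) (iota 0 w).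

(** Letting [j] range up to [x] loses nothing, since [eligible] demands [j.*2 <= elt w]. *)
Definition A_at (t x : nat) : bool :=
  has (fun w => (elt w == x) && has (fun j => acts j w) (iota 0 x.+1))
    (iota 0 t.+1).

Definition A_lim (x : nat) : bool := `[< exists t, A_at t x >].

Lemma acts_inj j w w' : acts j w -> acts j w' -> w = w'.
Proof.
move=> /andP[ew /hasPn nw] /andP[ew' /hasPn nw'].
have [lt|lt|//] := ltngtP w w'.
  by have := nw' w; rewrite mem_iota lt ew => /(_ isT).
by have := nw w'; rewrite mem_iota lt ew' => /(_ isT).
Qed.

Lemma A_atP t x : reflect (exists j w, [/\ acts j w, elt w = x & w <= t]) (A_at t x).
Proof.
apply: (iffP hasP) => [[w]|[j [w [aw wx wt]]]].
  rewrite mem_iota => wt /andP[/eqP wx /hasP[j _ aw]].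
  by exists j, w; split=> //; lia.
exists w; first by rewrite mem_iota; lia.
rewrite wx eqxx andTb; apply/hasP; exists j => //; rewrite mem_iota.
by case/andP: aw => /and4P[_ _ + _] _; rewrite wx; lia.
Qed.

Lemma A_limP x : A_lim x <-> exists j w, acts j w /\ elt w = x.
Proof.
split=> [/asboolP[t /A_atP[j [w [aw wx _]]]]|[j [w [aw wx]]]]; first by exists j, w.
by apply/asboolP; exists w; apply/A_atP; exists j, w.
Qed.

Lemma calc_eligible X A {cA : code A} (j w : A -> nat) :
  calc X j -> calc X w -> calc X (fun a => eligible (j a) (w a)).
Proof. by move=> Hj Hw; rewrite /eligible /W_stage; calc_auto. Qed.
#[local] Hint Resolve calc_eligible : calc.

Lemma calc_acts X A {cA : code A} (j w : A -> nat) :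
  calc X j -> calc X w -> calc X (fun a => acts (j a) (w a)).
Proof. by move=> Hj Hw; rewrite /acts; calc_auto. Qed.
#[global] Hint Resolve calc_acts : calc.

Lemma calc_A_at X A {cA : code A} (t x : A -> nat) :
  calc X t -> calc X x -> calc X (fun a => A_at (t a) (x a)).
Proof. by move=> Ht Hx; rewrite /A_at; calc_auto. Qed.
#[local] Hint Resolve calc_A_at : calc.

Lemma A_lim_ce : ce A_lim.
Proof.
have [|e He] := @ce_of_calc oracle0 (fun x t => A_at t x); first by calc_auto.
exists e; apply/seteqP; split=> x.
  by move=> /asboolP; rewrite /W /= He.
by rewrite /W /= He => H; apply/asboolP.
Qed.

Lemma A_lim_coinfinite : infinite_set (~` [set` A_lim]).
Proof.
move=> /finite_seqP[l El].
have [N HN] : exists N, forall x, N <= x -> A_lim x.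
  exists (\max_(x <- l) x).+1 => x Nx; apply: contraT => nx.
  have : x \in l.
    have : (~` [set` A_lim]) x by exact/negP.
    by rewrite El.
  by move=> xl; move: Nx; rewrite (big_rem x xl) /= ltnNge leq_maxl.
have /choice[J HJ] x : exists j, N <= x -> exists w, acts j w /\ elt w = x.
  have [Nx|Nx] := leqP N x; last by exists 0; lia.
  by have /A_limP[j [w Hw]] := HN _ Nx; exists j => _; exists w.
(* If all numbers from [N] on were in the set, the [N.+2] numbers from N to 2N+1 would have entered
   for distinct [j], all at most [N] because of [j.*2 <= elt w]. *)
have := @uniq_leq_size _ [seq J x | x <- iota N N.+2] (iota 0 N.+1).
rewrite size_map !size_iota ltnn => H; suff: false by []; apply: H.
  rewrite map_inj_in_uniq ?iota_uniq // => x y; rewrite !mem_iota.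
  move=> /andP[/HJ[w [aw wx]] _] /andP[/HJ[v [av vy]] _] E.
  by rewrite E in aw; rewrite -wx -vy (acts_inj aw av).
move=> _ /mapP[x xN ->]; move: xN; rewrite !mem_iota => /andP[Nx xN].
have [w [/andP[/and4P[_ _ + _] _] wx]] := HJ _ Nx.
by rewrite wx; lia.
Qed.

(** Summands above the digit [x] are multiples of 2^(x+1), and those below add up to less than
    2^x. *)
Lemma odd_sum_exp (P : pred nat) n x :
  odd (foldl (fun k y => k + P y * 2 ^ y) 0 (iota 0 n) %/ 2 ^ x) = (x < n) && P x.
Proof.
pose f m := foldl (fun k y => k + P y * 2 ^ y) 0 (iota 0 m); rewrite -/(f n).
have fS m : f m.+1 = f m + P m * 2 ^ m.
  by rewrite /f -[m.+1]addn1 iotaD add0n foldl_cat.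
have f_lt m : f m < 2 ^ m.
  by elim: m => // m IH; rewrite fS expnS; case: (P m); lia.
have gt0 m : 0 < 2 ^ m by rewrite expn_gt0.
elim: n => [|n IH]; first by rewrite div0n.
rewrite fS; have [xn|nx|->] := ltngtP x n.
- have -> : P n * 2 ^ n = P n * 2 ^ (n - x.+1) * 2 * 2 ^ x.
    by rewrite -!mulnA -expnS -expnD; congr (_ * 2 ^ _); lia.
  by rewrite divnDMl // oddD IH xn oddM andbF addbF ltnS ltnW.
- rewrite divn_small; first by rewrite ltnS leqNgt nx.
  apply: leq_trans (leq_pexp2l _ nx) => //.
  by have := f_lt n.+1; rewrite fS.
- by rewrite divnDMl // divn_small // add0n oddb ltnSn.
Qed.

(** Numbers up to [t] suffice: a number present at [t] is [elt w] for some [w <= t]. *)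
Definition A_index (t : nat) : nat :=
  foldl (fun k y => k + A_at t y * 2 ^ y) 0 (iota 0 t.+1).

Lemma elt_le w : elt w <= w.
Proof. by rewrite -{2}(pair_of_nat w); have [] := pair_code_ge (stage w) (elt w). Qed.

Lemma A_indexP t x : canonical_set (A_index t) x <-> A_at t x.
Proof.
change (odd (A_index t %/ 2 ^ x) <-> A_at t x).
rewrite /A_index odd_sum_exp; split=> [/andP[]//|H].
rewrite H andbT; case/A_atP: H => j [w [_ <- wt]].
by rewrite ltnS (leq_trans (elt_le w)).
Qed.

Lemma A_lim_enumeration : computable_enumeration A_lim A_index.
Proof.
split.
- by rewrite /A_index; apply: calc_computable; calc_auto.
- move=> s x /A_indexP/A_atP[j [w [aw wx ws]]]; apply/A_indexP/A_atP.
  by exists j, w; split=> //; exact: leqW.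
- apply/seteqP; split=> x.
    by move=> /asboolP[t At]; exists t => //; exact/A_indexP.
  by move=> [t _ /A_indexP At]; apply/asboolP; exists t.
Qed.

Lemma infinite_nat_unbounded (B : set nat) N :
  infinite_set B -> exists2 x, N <= x & B x.
Proof.
move=> infB; apply: contrapT => H; apply: infB.
apply: (@sub_finite_set _ _ `I_N) (finite_II N) => x Bx /=.
by rewrite ltnNge; apply/negP => Nx; apply: H; exists x.
Qed.

(** A member of [W e] that is at least [e.*2] and lies beyond the last change of the first [e.+1]
    predictions is eligible when it is enumerated. Hence some [w] acts for [e]. *)
Lemma A_lim_prompt e : infinite_set (W e) -> exists s x,
  (W_at e s `\` W_at e s.-1) x /\ canonical_set (A_index (pair_code s s)) x.
Proof.
move=> infW.
have [|s0 Hs0] := @eventually_all _ (iota 0 e.+1)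
    (fun i s => forall t, s <= t -> start i e t = start i e s).
  move=> i _; have [s0 Hs0] := start_cvg i e; exists s0 => s s0s t st.
  by rewrite !Hs0 // (leq_trans s0s).
have [x xN] := infinite_nat_unbounded (maxn s0 e.*2) infW.
rewrite geq_max in xN; case/andP: xN => s0x ex.
rewrite W_bigcup => -[s1 _ /W_stageP Ws1].
have [s Ws smin] := ex_minnP (ex_intro (fun s => W_stage e s x) s1 Ws1).
have xs : x < s by case/andP: Ws.
have el : exists w, eligible e w.
  exists (pair_code s x); rewrite /eligible !of_pair_code.
  apply/and4P; split => //; first by apply/negP => /smin /=; lia.
  apply/allP => i ie; apply/eqP/esym.
  exact: Hs0 _ s0x i ie _ (ltnW xs).
(* The least eligible [w] may differ from the one just found; its own stage and element are the
   witnesses. *)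
have [w ew wmin] := ex_minnP el; exists (stage w), (elt w).
case/and4P: (ew) => W1 /negP W2 _ _; split.
  by split; [exact/W_stageP|move/W_stageP].
apply/A_indexP/A_atP; exists e, w; split => //.
  rewrite /acts ew; apply/hasPn => v; rewrite mem_iota => vw.
  by apply/negP => /wmin; lia.
(* An element of [W_at e s] is below [s], so [pair_code s s] bounds [w]. *)
rewrite -{1}(pair_of_nat w); apply: leq_pair_code => //.
by case/andP: W1 => /ltnW.
Qed.

Lemma A_lim_promptly_simple : promptly_simple A_lim.
Proof.
split; [exact: A_lim_ce|exact: A_lim_coinfinite|].
exists (fun s => pair_code s s), A_index; split; [|exact: A_lim_enumeration|].
  by apply: calc_computable; calc_auto.
exact: A_lim_prompt.
Qed.

(* For a fixed i, the classes with j > m form level m of a Martin-Loef test. *)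
Definition captured (i j : nat) (Z : nat -> bool) : Prop :=
  exists2 w, acts j w &
    hit i j (start i j (stage w)) (stage w) (mkseq Z (stage w)).

Lemma start_homo i j : {homo start i j : s t / s <= t}.
Proof.
apply: homo_leq => // [|s]; first exact: leq_trans.
by rewrite /start -/start; case: ifP => // _; exact: leqW (start_le _ _ _).
Qed.

Lemma hit_mono i j t s s' Z : s <= s' ->
  hit i j t s (mkseq Z s) -> hit i j t s' (mkseq Z s').
Proof.
move=> ss /hasP[r]; rewrite mem_iota => /andP[tr rs].
rewrite take_mkseq; last by lia.
move=> H; apply/hasP; exists r; first by rewrite mem_iota; lia.
by rewrite take_mkseq //; lia.
Qed.

(** On input [x], the oracle [Z] is used to wait for a stage [S x] at which it meets the predictions
    of all blocks up to [x]. If [x] enters after that for a [j] above [i] and [k], then [Z] is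
    captured by [j], which is excluded. *)
Lemma A_lim_below i (Z : nat -> bool) k :
  (forall j, exists s0, forall s, s0 <= s -> hit i j (start i j s) s (mkseq Z s)) ->
  (forall j, k < j -> ~ captured i j Z) -> turing_le A_lim Z.
Proof.
move=> Zhit Zk.
pose ok x s := (x <= s) && all (fun j => hit i j (start i j s) s (mkseq Z s))
  (iota 0 x.+1).
have ex_ok x : exists s, ok x s.
  have [|s0 H] := @eventually_all _ (iota 0 x.+1)
      (fun j s => hit i j (start i j s) s (mkseq Z s)) => //.
  exists (maxn x s0); rewrite /ok leq_maxl andTb; apply/allP.
  exact: H (leq_maxr _ _).
pose S x := ex_minn (ex_ok x).
have SP x : ok x (S x) by rewrite /S; case: ex_minnP.
(* Every [w] with element [x] and stage at most [S x] is bounded by this code. *)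
pose B x := A_at (pair_code (S x) x) x.
(* The small [j] act at most once each and so yield finitely many exceptions. *)
have [L HL] : exists L : seq nat,
    forall j w, j <= maxn i k -> acts j w -> elt w \in L.
  elim: (maxn i k).+1 {-2}(maxn i k) (ltnSn (maxn i k)) => // n IH m mn.
  have [L HL] : exists L : seq nat, forall j w, j < m -> acts j w -> elt w \in L.
    case: m mn => [|m] mn; first by exists [::].
    by have [L HL] := IH m mn; exists L => j w; exact: HL.
  have [[w aw]|N] := pselect (exists w, acts m w).
    exists (elt w :: L) => j v; rewrite leq_eqVlt => /predU1P[->|jm] av.
      by rewrite (acts_inj av aw) mem_head.
    by rewrite inE (HL _ _ jm av) orbT.
  exists L => j v; rewrite leq_eqVlt => /predU1P[->|jm] av; last exact: HL av.
  by case: N; exists v.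
have E x : A_lim x = B x || (A_lim x && (x \in L)).
  apply/idP/idP => [Ax|/orP[Bx|/andP[]//]]; last first.
    by apply/asboolP; exists (pair_code (S x) x).
  rewrite Ax; have [//|nB] := boolP (B x); rewrite /=.
  have /A_limP[j [w [aw wx]]] := Ax.
  have [jk|jk] := leqP j (maxn i k); first by rewrite -wx; exact: HL aw.
  move: jk; rewrite gtn_max => /andP[ij kj].
  have /andP[xS /allP hS] := SP x.
  have Sw : S x < stage w.
    rewrite ltnNge; apply: contraNN nB => wS; apply/A_atP; exists j, w; split=> //.
    by rewrite -{1}(pair_of_nat w) wx; exact: leq_pair_code.
  case/andP: (aw) => /and4P[_ _ jx /allP st] _.
  case: (Zk j kj); exists w => //.
  have /eqP Est : start i j (elt w) == start i j (stage w).
    by apply: st; rewrite mem_iota ltnS (ltnW ij).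
  (* [S x] lies between [x] and the stage of [w], and eligibility says that the prediction did not
     change in between. *)
  have -> : start i j (stage w) = start i j (S x).
    apply/eqP; rewrite eqn_leq (start_homo _ _ (ltnW Sw)) andbT.
    by rewrite -Est wx; exact: start_homo.
  apply: hit_mono (ltnW Sw) _; apply: hS; rewrite mem_iota /=.
  by rewrite wx in jx; lia.
apply: calc_computable; apply: calc_nat_of_bool.
(* The exceptions that do enter the set form a finite list, built into the program as a constant. *)
pose L' : seq nat := [seq x <- L | A_lim x].
apply: (@calc_ext _ _ _ _ _ (fun x => B x || has (fun y : nat => x == y) L')).
  move=> x; rewrite E -mem_filter; congr (_ || _).
  by apply/hasP/idP => [[y yL /eqP ->]//|xL]; exists x.
have HS : calc Z S.
  apply: (@calc_search _ _ _ ok).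
  - have HZ A (cA : code A) (f : A -> nat) : calc Z f -> calc Z (fun a => Z (f a)).
      exact: calc_oracle.
    by rewrite /ok; calc_auto.
  - exact: SP.
  - move=> x n; rewrite /S; case: ex_minnP => m _ mmin nm.
    by apply/negP => /mmin; lia.
by rewrite /B; apply: calc_orb; [|apply: calc_has]; calc_auto.
Qed.

(** * The Martin-Loef test *)

Lemma string_code_inj : injective string_code.
Proof.
rewrite /string_code; set v := foldl _ 1.
have v_rcons s b : v (rcons s b) = b + (v s).*2 by rewrite /v foldl_rcons.
have v_gt0 s : 0 < v s.
  by elim/last_ind: s => // s b IH; rewrite v_rcons addn_gt0 double_gt0 IH orbT.
move=> s t E; have {E} : v s = v t by have := v_gt0 s; have := v_gt0 t; lia.
elim/last_ind: s t => [|s b IH] t; case/lastP: t => [//|t c]; rewrite ?v_rcons.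
- by have := v_gt0 t; rewrite (_ : v [::] = 1) //; lia.
- by have := v_gt0 s; rewrite (_ : v [::] = 1) //; lia.
- move=> E; have bc : b = c.
    by move/(congr1 odd): E; rewrite !oddD !odd_double !addbF !oddb.
  by rewrite bc (IH t) //; move: E; rewrite bc => /addnI/double_inj.
Qed.

Lemma cylinder_mkseq n (Z : nat -> bool) sigma :
  size sigma = n -> cylinder sigma Z <-> mkseq Z n = sigma.
Proof. by move=> <-. Qed.

Section measure.
Variable R : realType.
Local Notation coin := (g_sigma_algebraType (range cylinder)).
Local Notation mu := (fair_coin R).

Lemma measurable_cylinder sigma : measurable (cylinder sigma : set coin).
Proof. by apply: sub_sigma_algebra; exists sigma. Qed.

Lemma fair_coin_cylinders n (l : seq (seq bool)) :
  (forall sigma, sigma \in l -> size sigma = n) ->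
  measurable (\big[setU/set0]_(sigma <- l) cylinder sigma : set coin) /\
  (mu (\big[setU/set0]_(sigma <- l) cylinder sigma) <=
    ((size l)%:R * 2 ^- n)%R%:E)%E.
Proof.
elim: l => [|s l IH] Hl.
  by rewrite big_nil measure0 mul0r; split; [exact: measurable0|].
have [|mIH IHle] := IH; first by move=> t tl; apply: Hl; rewrite inE tl orbT.
rewrite big_cons; split.
  by apply: measurableU => //; exact: measurable_cylinder.
apply: (@le_trans _ _ (mu (cylinder s) +
    mu (\big[setU/set0]_(sigma <- l) cylinder sigma))%E).
  by apply: measureU2 => //; exact: measurable_cylinder.
rewrite fair_coin_cylinder (Hl s) ?mem_head // [size (s :: l)]/=.
rewrite -[(size l).+1%:R%R]natr1 mulrDl mul1r addrC EFinD.
exact: leeD2r.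
Qed.

(** Since [j] acts at most once, the class is given by strings of a single length, and
    [weight_start] bounds their number. *)
Lemma captured_measure i j :
  measurable ([set Z | captured i j Z] : set coin) /\
  (mu [set Z | captured i j Z] <= (2 ^- j)%R%:E)%E.
Proof.
have [[w aw]|N] := pselect (exists w, acts j w); last first.
  have -> : [set Z | captured i j Z] = set0.
    by apply/seteqP; split=> // Z [w aw]; case: N; exists w.
  by rewrite measure0; split=> //; rewrite lee_fin invr_ge0 exprn_ge0.
set u := stage w; pose t := start i j u.
pose l := [seq sigma <- strings u | hit i j t u sigma].
have -> : [set Z | captured i j Z] = \big[setU/set0]_(sigma <- l) cylinder sigma.
  rewrite -bigcup_seq; apply/seteqP; split=> Z /=.
    move=> [v av hv]; rewrite (acts_inj av aw) -/u -/t in hv.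
    exists (mkseq Z u); first by rewrite /= mem_filter hv mem_strings size_mkseq /=.
    by rewrite /cylinder /= size_mkseq.
  move=> [sigma /=]; rewrite mem_filter mem_strings => /andP[hs /eqP su].
  by move=> /(cylinder_mkseq _ su) E; exists w => //; rewrite -/u E.
have [|ml le] := @fair_coin_cylinders u l.
  by move=> sigma; rewrite mem_filter mem_strings => /andP[_ /eqP].
split=> //; apply: (le_trans le); rewrite lee_fin.
rewrite ler_pdivrMr ?exprn_gt0 // mulrC ler_pdivlMr ?exprn_gt0 //.
by rewrite -!natrX -natrM ler_nat; exact: weight_start.
Qed.

(** The decidable matrix for the c.e. index of the test. The witness [p] codes a block together with
    the [w] on which it acts, so [stage p] is here the block; [c] codes a string. *)
Definition captured_test (i m : nat) (c p : nat) : bool :=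
  [&& m < stage p, acts (stage p) (elt p) &
    has (fun sigma => (string_code sigma == c) &&
        hit i (stage p) (start i (stage p) (stage (elt p))) (stage (elt p)) sigma)
      (strings (stage (elt p)))].

(** Level [m] of the test is the union of the classes with [j > m]. If [Z] were captured for
    unboundedly many [j], it would lie in every level. *)
Lemma captured_bound i (Z : nat -> bool) : ml_random R Z ->
  exists k, forall j, k < j -> ~ captured i j Z.
Proof.
move=> randZ.
have [|e He] := @ce_of_calc oracle0 (fun n p =>
    captured_test i (Cantor.of_nat n).1 (Cantor.of_nat n).2 p).
  by rewrite /captured_test; calc_auto.
pose G m : set coin := \bigcup_(sigma in
  [set sigma | W e (pair_code m (string_code sigma))]) cylinder sigma.
have GE m : G m = \bigcup_n [set Z | captured i (m.+1 + n) Z].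
  apply/seteqP; split=> Y.
    move=> [sigma /= /He[p]]; rewrite of_pair_code /=.
    move=> /and3P[mj aw /hasP[tau]]; rewrite mem_strings => /eqP st.
    move=> /andP[/eqP/string_code_inj <-] hs /(cylinder_mkseq _ st) E.
    exists (stage p - m.+1) => //=; rewrite subnKC //.
    by exists (elt p) => //; rewrite E.
  move=> [n _ [w aw hw]]; exists (mkseq Y (stage w)); last first.
    by rewrite /cylinder /= size_mkseq.
  apply/He; exists (pair_code (m.+1 + n) w).
  rewrite /captured_test !of_pair_code; apply/and3P; split=> //=.
    by rewrite leq_addr.
  apply/hasP; exists (mkseq Y (stage w)); first by rewrite mem_strings size_mkseq.
  by rewrite eqxx.
have test : ml_test R G.
  split; first by exists e.
  move=> m; rewrite GE.
  apply: (@le_trans _ _ (\sum_(0 <= n <oo) mu [set Z | captured i (m.+1 + n) Z])%E).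
    apply: measure_sigma_subadditive => //.
      by move=> n; have [] := captured_measure i (m.+1 + n).
    apply: bigcupT_measurable => n.
    by have [] := captured_measure i (m.+1 + n).
  have e0 : (0 <= 2 ^- m :> R)%R by rewrite invr_ge0 exprn_ge0.
  (* The bounds 2^-(m+1+n) sum to 2^-m over all [n], which is why the blocks start at [m.+1]. *)
  apply: le_trans (epsilon_trick0 xpredT e0).
  apply: lee_nneseries => // n _; have [_] := captured_measure i (m.+1 + n).
  move=> /le_trans; apply; rewrite lee_fin natrX -invfM -exprD.
  by rewrite addSnnS addnC.
apply: contrapT => N; apply: (randZ G test) => m _; rewrite GE.
have [j mj Zj] : exists2 j, m < j & captured i j Z.
  apply: contrapT => N'; apply: N; exists m => j mj Zj; apply: N'.
  by exists j.
by exists (j - m.+1) => //=; rewrite subnKC.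
Qed.

End measure.

Theorem corollary3p5 (R : realType) :
  exists A : nat -> bool,
    promptly_simple A /\
    forall Z : nat -> bool, superhigh Z -> ml_random R Z -> turing_le A Z.
Proof.
exists A_lim; split; first exact: A_lim_promptly_simple.
move=> Z /superhigh_hit[i Zhit] /(captured_bound i)[k Zk].
exact: A_lim_below Zhit Zk.
Qed.
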